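(* Let $\mathcal{A}$ be a unital algebra and let $\mathscr{B}$ be a class of Banach spaces stable under finite sums and containing the zero space. Let $u$ be an invertible element of the matrix algebra $\mathrm{M}_n(\mathcal{A})$ and let $(X,\pi,F)$ be an odd Banach Fredholm module over $\mathcal{A}$ with $\pi(1)=\mathrm{Id}_X$. Define the bounded operators $P_n := \mathrm{Id}\otimes\frac{\mathrm{Id}+F}{2} : X^{\oplus n}\to X^{\oplus n}$ and $u_n := (\mathrm{Id}\otimes\pi)(u) : X^{\oplus n}\to X^{\oplus n}$. Then the bounded operator $$P_n u_n P_n-(\mathrm{Id}-P_n) : X^{\oplus n}\to X^{\oplus n}$$ is Fredholm. Moreover, if $X$ belongs to $\mathscr{B}$, its Fredholm index depends only on the class $[u]\in \mathrm{K}_1(\mathcal{A})$ and on the class $[(X,\pi,F)]\in \mathrm{K}^1(\mathcal{A},\mathscr{B})$ (for this last assertion $\mathcal{A}$ is a unital Banach algebra, so that $\mathrm{K}_1(\mathcal{A})$ is defined).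
   Context: Algebras and Banach spaces are complex. An odd Banach Fredholm module $(X,\pi,F)$ over an algebra $\mathcal{A}$ consists of a Banach space $X$, a representation (algebra homomorphism) $\pi:\mathcal{A}\to \mathrm{B}(X)$ into the bounded operators on $X$, and a bounded operator $F:X\to X$ such that $F^2-\mathrm{Id}_X$ is compact and $[F,\pi(a)]$ is compact for every $a\in\mathcal{A}$. It is degenerate if $F^2=\mathrm{Id}_X$ and $[F,\pi(a)]=0$ for all $a\in\mathcal{A}$. If $U:Y\to X$ is an isomorphism of Banach spaces (not necessarily isometric), $(Y,U^{-1}\pi U,U^{-1}FU)$ is said to be isomorphic to $(X,\pi,F)$. Two modules $(X,\pi,F_0)$, $(X,\pi,F_1)$ are operator homotopic if there is a norm-continuous path $t\in[0,1]\mapsto F_t\in \mathrm{B}(X)$ joining $F_0$ to $F_1$ such that each $(X,\pi,F_t)$ is an odd Banach Fredholm module. Direct sums are taken componentwise. $\mathrm{K}^1(\mathcal{A},\mathscr{B})$ is the abelian group with one generator $[(X,\pi,F)]$ for each isomorphism class of odd Banach Fredholm modules over $\mathcal{A}$ with $X$ in $\mathscr{B}$, subject only to the relations: (1) operator homotopic modules have the same class; (2) $[(X_0,\pi_0,F_0)\oplus(X_1,\pi_1,F_1)]=[(X_0,\pi_0,F_0)]+[(X_1,\pi_1,F_1)]$; (3) degenerate modules have class $0$. For a unital Banach algebra $\mathcal{A}$, $\mathrm{GL}_n(\mathcal{A})$ is the topological group of invertible $n\times n$ matrices with entries in $\mathcal{A}$, $\mathrm{GL}_\infty(\mathcal{A})=\varinjlim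 \mathrm{GL}_n(\mathcal{A})$ along $x\mapsto \mathrm{diag}(x,1)$, and $\mathrm{K}_1(\mathcal{A}):=\pi_0(\mathrm{GL}_\infty(\mathcal{A}))$. A bounded operator $T:X\to Y$ is Fredholm if $\ker T$ and $Y/\mathrm{Ran}\,T$ are finite-dimensional, and its index is then $\dim\ker T-\dim Y/\mathrm{Ran}\,T$. *)

(* Defs.v *)
From HB Require Import structures.
From mathcomp Require Import all_boot all_order all_algebra.
From mathcomp Require Import complex.
From mathcomp Require Import all_classical all_reals all_analysis.

Set Implicit Arguments.
Unset Strict Implicit.
Unset Printing Implicit Defensive.

Import Order.TTheory GRing.Theory Num.Theory.
Import numFieldNormedType.Exports.

Local Open Scope classical_set_scope.
Local Open Scope ring_scope.

Section Operators.
Context {K : numFieldType}.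

Definition bounded_op (X Y : normedModType K) (T : X -> Y) : Prop :=
  linear T /\ exists M : K, forall x, `|T x| <= M * `|x|.

Definition compact_op (X Y : normedModType K) (T : X -> Y) : Prop :=
  precompact (T @` [set x | `|x| <= 1]).

(* Isomorphism of Banach spaces, not necessarily isometric. *)
Definition banach_iso (X Y : normedModType K)
    (U : X -> Y) (V : Y -> X) : Prop :=
  [/\ bounded_op U, bounded_op V, cancel U V & cancel V U].

(* For subspaces W <= V of X: the classes modulo W of some d vectors of V form
   a basis of V / W. *)
Definition has_quot_dim (X : lmodType K) (V W : set X) (d : nat) : Prop :=
  exists e : 'I_d -> X,
    [/\ forall i, V (e i),
        forall c : 'I_d -> K, W (\sum_i c i *: e i) -> forall i, c i = 0
      & forall x, V x -> exists c : 'I_d -> K, W (x - \sum_i c i *: e i)].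

Definition finite_quot_dim (X : lmodType K) (V W : set X) : Prop :=
  exists d, has_quot_dim V W d.

Definition quot_dim (X : lmodType K) (V W : set X) : nat :=
  get [set d | has_quot_dim V W d].

Definition ker_set (X Y : lmodType K) (T : X -> Y) : set X := [set x | T x = 0].

Definition fredholm (X Y : completeNormedModType K) (T : X -> Y) : Prop :=
  [/\ bounded_op T, finite_quot_dim (ker_set T) [set 0]
    & finite_quot_dim [set: Y] (range T)].

Definition fredholm_index (X Y : completeNormedModType K) (T : X -> Y) : int :=
  (quot_dim (ker_set T) [set 0])%:Z - (quot_dim [set: Y] (range T))%:Z.

End Operators.

(* The Banach space X^{(+) n}, normed by the sum of the norms of the
   components (all the usual norms on it are equivalent) *)

Definition bsum (n : nat) (X : Type) : Type := {ffun 'I_n -> X}.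

Section BanachSum.
Context (K : numFieldType) (n : nat).

HB.instance Definition _ (X : lmodType K) :=
  GRing.Lmodule.copy (bsum n X) {ffun 'I_n -> X}.

Section Norm.
Context (X : normedModType K).

Definition bsum_norm (x : bsum n X) : K := \sum_i `|x i|.

Fact bsum_normD (x y : bsum n X) :
  bsum_norm (x + y) <= bsum_norm x + bsum_norm y.
Proof.
rewrite /bsum_norm -big_split; apply: ler_sum => i _.
by rewrite ffunE ler_normD.
Qed.

Fact bsum_normZ (c : K) (x : bsum n X) :
  bsum_norm (c *: x) = `|c| * bsum_norm x.
Proof.
by rewrite /bsum_norm mulr_sumr; apply: eq_bigr => i _; rewrite ffunE normrZ.
Qed.

Fact bsum_norm_eq0 (x : bsum n X) : bsum_norm x = 0 -> x = 0.
Proof.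
move=> /eqP; rewrite psumr_eq0 => [/allP x0|i _]; last exact: normr_ge0.
apply/ffunP => i; rewrite ffunE; apply/eqP; rewrite -normr_eq0.
by apply: x0; rewrite mem_index_enum.
Qed.

HB.instance Definition _ := Lmodule_isNormed.Build K (bsum n X)
  bsum_normD bsum_normZ bsum_norm_eq0.

Lemma bsum_normE (x : bsum n X) : `|x| = \sum_i `|x i|.
Proof. by []. Qed.

End Norm.

Fact bsum_complete (X : completeNormedModType K) (F : set_system (bsum n X)) :
  ProperFilter F -> cauchy F -> cvg F.
Proof.
move=> FF /cauchy_ballP Fc.
have cvgi (i : 'I_n) : cvg ((fun x : bsum n X => x i) @ F).
  apply: cauchy_cvg; apply/cauchy_ballP => e e0.
  have := Fc e e0; rewrite !near_simpl => /= -[[P Q]] /= [FP FQ] PQ.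
  exists ([set x i | x in P], [set x i | x in Q]) => /=.
    split; rewrite /nbhs /=.
      by apply: filterS FP => x Px; exists x.
    by apply: filterS FQ => x Qx; exists x.
  move=> [_ _] /= [[x Px <-] [y Qy <-]].
  have := PQ (x, y) (conj Px Qy).
  rewrite -ball_normE /= -ball_normE /=; apply: le_lt_trans.
  rewrite bsum_normE (bigD1 i) //= !ffunE lerDl.
  by apply: sumr_ge0 => j _; exact: normr_ge0.
pose l : bsum n X := [ffun i => lim ((fun x : bsum n X => x i) @ F)].
apply/cvg_ex; exists l; apply/cvgrPdist_lt => e e0.
have en0 : 0 < e / n.+1%:R by rewrite divr_gt0.
have H : F [set x : bsum n X | forall i : 'I_n, `|l i - x i| < e / n.+1%:R].
  apply: filter_forall => i; have /cvgrPdist_lt := cvgi i => /(_ _ en0).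
  by apply: filterS => x; rewrite /l ffunE.
apply: filterS H => x xl.
rewrite bsum_normE.
have -> : e = \sum_(i < n.+1) e / n.+1%:R.
  by rewrite sumr_const card_ord -[RHS]mulr_natr divfK // pnatr_eq0.
rewrite big_ord_recr /= ltr_pwDr //; apply: ler_sum => i _.
by have /ltW := xl i; rewrite !ffunE.
Qed.

HB.instance Definition _ (X : completeNormedModType K) :=
  Uniform_isComplete.Build (bsum n X) (@bsum_complete X).

End BanachSum.

Section FredholmModules.
Context {K : numFieldType} (A : algType K).

(* pi need be neither unital nor, when A is normed, continuous. *)
Definition representation (X : completeNormedModType K)
    (pi : A -> X -> X) : Prop :=
  [/\ forall a, bounded_op (pi a),
      forall (c : K) a b x, pi (c *: a + b) x = c *: pi a x + pi b x
    & forall a b x, pi (a * b) x = pi a (pi b x)].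

Definition odd_fredholm (X : completeNormedModType K)
    (pi : A -> X -> X) (F : X -> X) : Prop :=
  [/\ representation pi, bounded_op F, compact_op (fun x => F (F x) - x)
    & forall a, compact_op (fun x => F (pi a x) - pi a (F x))].

Record fredholm_module := FredholmModule {
  fm_space :> completeNormedModType K;
  fm_rep : A -> fm_space -> fm_space;
  fm_op : fm_space -> fm_space;
  fm_odd_fredholm : odd_fredholm fm_rep fm_op
}.

Definition degenerate (M : fredholm_module) : Prop :=
  (forall x : M, fm_op (fm_op x) = x) /\
  forall a (x : M), fm_op (fm_rep a x) = fm_rep a (fm_op x).

Definition fm_isomorphic (M N : fredholm_module) : Prop :=
  exists (U : N -> M) (V : M -> N),
    [/\ banach_iso U V,
        forall a x, fm_rep a x = V (fm_rep a (U x))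
      & forall x, fm_op x = V (fm_op (U x))].

(* M is isomorphic to the componentwise direct sum of M0 and M1. *)
Definition fm_direct_sum (M M0 M1 : fredholm_module) : Prop :=
  exists (U : M -> (M0 * M1)%type) (V : (M0 * M1)%type -> M),
    [/\ banach_iso U V,
        forall a x, fm_rep a x = V (fm_rep a (U x).1, fm_rep a (U x).2)
      & forall x, fm_op x = V (fm_op (U x).1, fm_op (U x).2)].

Definition unital (M : fredholm_module) : Prop := forall x : M, fm_rep 1 x = x.

Variables (M : fredholm_module) (n : nat).

Definition Pn (x : bsum n M) : bsum n M :=
  [ffun i => 2^-1 *: (x i + fm_op (x i))].

Definition un (u : 'M[A]_n) (x : bsum n M) : bsum n M :=
  [ffun i => \sum_j fm_rep (u i j) (x j)].

Definition compression (u : 'M[A]_n) (x : bsum n M) : bsum n M :=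
  Pn (un u (Pn x)) - (x - Pn x).

End FredholmModules.

Arguments compression {K A} M {n} u x.

Definition invertible_mx (A : pzRingType) (n : nat) (u : 'M[A]_n) : Prop :=
  exists v : 'M[A]_n, u *m v = 1%:M /\ v *m u = 1%:M.

Section OperatorHomotopy.
Context {R : realType} (A : algType R[i]).

Definition opnorm (X Y : normedModType R[i]) (T : X -> Y) : R :=
  sup [set complex.Re `|T x| | x in [set x : X | `|x| <= 1]].

Definition operator_homotopic (X : completeNormedModType R[i])
    (pi : A -> X -> X) (F0 F1 : X -> X) : Prop :=
  exists F : R -> X -> X,
    [/\ F 0 = F0, F 1 = F1,
        forall t, t \in `[0, 1] -> odd_fredholm pi (F t)
      & forall t, t \in `[0, 1] ->
          opnorm (fun x => F s x - F t x) @[s --> within `[0, 1] (nbhs t)]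
            --> (0 : R)].

End OperatorHomotopy.

Section Khom.
Context {R : realType}.
Variable (B : completeNormedModType R[i] -> Prop).

Definition contains_zero_space : Prop :=
  exists Z : completeNormedModType R[i], B Z /\ forall z : Z, z = 0.

(* B need not contain X * Y with the maximum norm of the library, only a Banach
   space isomorphic to it: this leaves the choice of the norm on direct sums
   (maximum, l^p, ...) to the class B. *)
Definition stable_under_sums : Prop :=
  forall X Y : completeNormedModType R[i], B X -> B Y ->
  exists Z : completeNormedModType R[i],
    B Z /\
    exists (U : Z -> (X * Y)%type) (V : (X * Y)%type -> Z), banach_iso U V.

Variable (A : algType R[i]).

(* K^1(A, B) is given by generators and relations: formal expressions in the
   generators, modulo the congruence generated by the abelian group axioms and
   the defining relations. *)
Inductive khom_word : Type :=
| KhomGen (M : fredholm_module A) of B M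
| KhomZero
| KhomOpp of khom_word
| KhomAdd of khom_word & khom_word.

Inductive khom_rel : khom_word -> khom_word -> Prop :=
| khom_refl x : khom_rel x x
| khom_sym x y : khom_rel x y -> khom_rel y x
| khom_trans x y z : khom_rel x y -> khom_rel y z -> khom_rel x z
| khom_opp x y : khom_rel x y -> khom_rel (KhomOpp x) (KhomOpp y)
| khom_add x x' y y' :
    khom_rel x x' -> khom_rel y y' -> khom_rel (KhomAdd x y) (KhomAdd x' y')
| khom_addA x y z :
    khom_rel (KhomAdd x (KhomAdd y z)) (KhomAdd (KhomAdd x y) z)
| khom_addC x y : khom_rel (KhomAdd x y) (KhomAdd y x)
| khom_add0 x : khom_rel (KhomAdd KhomZero x) x
| khom_addN x : khom_rel (KhomAdd (KhomOpp x) x) KhomZero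
| khom_isomorphic (M N : fredholm_module A) (hM : B M) (hN : B N) :
    fm_isomorphic M N -> khom_rel (KhomGen hM) (KhomGen hN)
| khom_homotopic (X : completeNormedModType R[i]) (hX : B X)
    (pi : A -> X -> X) (F0 F1 : X -> X)
    (h0 : odd_fredholm pi F0) (h1 : odd_fredholm pi F1) :
    operator_homotopic pi F0 F1 ->
    khom_rel (@KhomGen (FredholmModule h0) hX) (@KhomGen (FredholmModule h1) hX)
| khom_direct_sum (M M0 M1 : fredholm_module A)
    (hM : B M) (h0 : B M0) (h1 : B M1) :
    fm_direct_sum M M0 M1 ->
    khom_rel (KhomGen hM) (KhomAdd (KhomGen h0) (KhomGen h1))
| khom_degenerate (M : fredholm_module A) (hM : B M) :
    degenerate M -> khom_rel (KhomGen hM) KhomZero.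

(* The elements of K^1(A, B) are the equivalence classes of khom_rel, with the
   group law induced by KhomAdd.  They are kept as predicates: khom_word is too
   large a type (it ranges over all Banach spaces) to be an eqType, hence for
   K^1(A, B) to be a zmodType. *)
Definition khom_class (M : fredholm_module A) (hM : B M) : khom_word -> Prop :=
  khom_rel (KhomGen hM).

End Khom.

(* The library's hierarchy has no join of algebras and normed modules; the norm
   is therefore carried by the alias normed_space A of A. *)
Record normed_algebra (K : numFieldType) := NormedAlgebra {
  na_alg :> algType K;
  na_norm : na_alg -> K;
  na_normD : forall a b, na_norm (a + b) <= na_norm a + na_norm b;
  na_normZ : forall (c : K) a, na_norm (c *: a) = `|c| * na_norm a;
  na_norm_eq0 : forall a, na_norm a = 0 -> a = 0;
  na_normM : forall a b, na_norm (a * b) <= na_norm a * na_norm b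
}.

Definition normed_space (K : numFieldType) (A : normed_algebra K) : Type := A.

HB.instance Definition _ (K : numFieldType) (A : normed_algebra K) :=
  GRing.Lmodule.copy (normed_space A) (na_alg A).
HB.instance Definition _ (K : numFieldType) (A : normed_algebra K) :=
  Lmodule_isNormed.Build K (normed_space A)
    (@na_normD K A) (@na_normZ K A) (@na_norm_eq0 K A).

Record banach_algebra (K : numFieldType) := BanachAlgebra {
  ba_normed :> normed_algebra K;
  ba_complete : forall F : set_system (normed_space ba_normed),
    ProperFilter F -> cauchy F -> cvg F
}.

HB.instance Definition _ (K : numFieldType) (A : banach_algebra K) :=
  Uniform_isComplete.Build (normed_space A) (@ba_complete K A).

Section GLinfinity.
Context {K : numFieldType} (A : banach_algebra K).

(* Used as a type, GLn n has the subspace topology of the matrices, whose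
   topology is that of entrywise convergence in norm. *)
Definition GLn (n : nat) : set 'M[normed_space A]_n :=
  [set u | invertible_mx (u : 'M[A]_n)].

(* The infinite matrix diag(u, 1, 1, ...). *)
Definition stabilize (n : nat) (u : 'M[A]_n) : nat -> nat -> A := fun i j =>
  match (insub i : option 'I_n), (insub j : option 'I_n) with
  | Some i', Some j' => u i' j'
  | _, _ => (i == j)%:R
  end.

Record GLoo := MkGLoo {
  GLoo_val : nat -> nat -> A;
  GLoo_prop : exists n (u : 'M[A]_n), invertible_mx u /\ GLoo_val = stabilize u
}.

HB.instance Definition _ := gen_eqMixin GLoo.
HB.instance Definition _ := gen_choiceMixin GLoo.

Definition GLoo_of (n : nat) (u : 'M[A]_n) (hu : invertible_mx u) : GLoo :=
  @MkGLoo (stabilize u)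
    (ex_intro _ n (ex_intro _ u (conj hu (erefl (stabilize u))))).

Definition GLn_to_GLoo (n : nat) (u : @GLn n) : GLoo := GLoo_of (set_valP u).

(* The inductive limit topology. *)
Definition GLoo_open (V : set GLoo) : Prop :=
  forall n, open (@GLn_to_GLoo n @^-1` V).

Fact GLoo_openT : GLoo_open setT.
Proof. by move=> n; rewrite preimage_setT; exact: openT. Qed.

Fact GLoo_openI : setI_closed GLoo_open.
Proof. by move=> V W oV oW n; rewrite preimage_setI; exact: openI. Qed.

Fact GLoo_open_bigcup (I : Type) (V : I -> set GLoo) :
  (forall i, GLoo_open (V i)) -> GLoo_open (\bigcup_i V i).
Proof.
by move=> oV n; rewrite preimage_bigcup; apply: bigcup_open => i _; exact: oV.
Qed.

HB.instance Definition _ := isOpenTopological.Build GLoo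
  GLoo_openT GLoo_openI GLoo_open_bigcup.

End GLinfinity.

Definition path_component (R : realType) (T : topologicalType) (x : T) :
    set T :=
  [set y | exists g : R -> T,
     [/\ {within `[0, 1], continuous g}, g 0 = x & g 1 = y]].

(* The class [u] in K_1(A), as a path component of GL_oo(A). *)
Definition K1_class (R : realType) (A : banach_algebra R[i]) (n : nat)
    (u : 'M[A]_n) (hu : invertible_mx u) : set (GLoo A) :=
  path_component R (GLoo_of hu).

(* Main.v *)
Require Import Defs.
From HB Require Import structures.
From mathcomp Require Import all_boot all_order all_algebra.
From mathcomp Require Import complex.
From mathcomp Require Import all_classical all_reals all_analysis.
From mathcomp Require Import zify ring lra.

Set Implicit Arguments.
Unset Strict Implicit.
Unset Printing Implicit Defensive.

Import Order.TTheory GRing.Theory Num.Theory.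
Import numFieldNormedType.Exports.

Local Open Scope classical_set_scope.
Local Open Scope ring_scope.

(** Why the index is well defined. Write P = (1 + F) / 2. Modulo compact
operators P is idempotent and commutes with the entries of u, so the compression
P u P - (1 - P) agrees modulo compacts with the half-Toeplitz operator
T(u) = P u - (1 - P), and T(u) T(v) agrees with P u v + (1 - P). For v the inverse
of u the latter is 1: T(u) and T(v) are inverse to one another modulo compacts.
Fredholmness then follows from Riesz theory ([index_one_minus_compact]: 1 - K is
Fredholm of index 0 for K compact) and the index of T(u) is unchanged under
compact perturbations ([index_compact_perturb]). Together with the additivity of
the index under composition ([has_index_comp]) this shows that the index of T is
a homomorphism from invertible matrices to the integers
([half_toeplitz_indexM]); the constant matrix 1 has index 0 because
T(1) T(1) = 1 modulo compacts.

Dependence on the class in K-homology. The defining relations of K^1 relate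
unital modules through arbitrary ones, so the index is first extended to all
modules, replacing pi(u) by its unitization pi(u) + (1 - pi(1)), which is again
invertible and multiplicative in u. The extended index is transported by
isomorphisms, additive on direct sums, and 0 on degenerate modules, where T(u) is
honestly invertible. For operator homotopies, T(u) is affine in F, so it moves
continuously in norm; the index is locally constant in norm ([index_perturb]),
hence constant on [0, 1]. Sending each generator of K^1 to its index therefore
respects every relation ([khom_rel_index]).

Dependence on the class in K-theory. The representation pi is not assumed to be
continuous, so a path of invertible matrices need not give a continuous path of
operators. Algebra replaces continuity: a matrix close to 1 has square roots that
are again close to 1 ([mx_sqrt_near1]), hence roots of all orders 2 ^ k, and since
the index is a homomorphism its value is divisible by all powers of 2, that is, it
vanishes ([index_near1]). So the index is locally constant on every GL_n(A). It is
unchanged when u is replaced by diag(u, 1) ([mod_index_stabilize]), hence descends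
to a locally constant function on the inductive limit, which is constant along
paths ([K1_class_index]). *)

(** * Dimensions of quotients and the algebraic index *)

Section LinearAlgebra.
Context {K : numFieldType}.
Implicit Types X Y Z : lmodType K.

Definition subspace_set X (W : set X) : Prop :=
  W 0 /\ forall (c : K) x y, W x -> W y -> W (c *: x + y).

Lemma subspace_setD X (W : set X) x y :
  subspace_set W -> W x -> W y -> W (x + y).
Proof. by move=> [_ h] wx wy; have := h 1 _ _ wx wy; rewrite scale1r. Qed.

Lemma subspace_setZ X (W : set X) c x : subspace_set W -> W x -> W (c *: x).
Proof. by move=> [w0 h] wx; have := h c _ _ wx w0; rewrite addr0. Qed.

Lemma subspace_setN X (W : set X) x : subspace_set W -> W x -> W (- x).
Proof. by move=> sW wx; rewrite -scaleN1r; exact: subspace_setZ. Qed.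

Lemma subspace_setB X (W : set X) x y :
  subspace_set W -> W x -> W y -> W (x - y).
Proof. by move=> sW wx wy; apply: subspace_setD => //; exact: subspace_setN. Qed.

Lemma subspace_set_sum X (W : set X) (I : finType) (f : I -> X) :
  subspace_set W -> (forall i, W (f i)) -> W (\sum_i f i).
Proof.
move=> sW fW; elim/big_ind : _ => //; first exact: sW.1.
by move=> x y; exact: subspace_setD.
Qed.

Lemma subspace_set0 X : subspace_set [set (0 : X)].
Proof. by split=> // c x y -> ->; rewrite scaler0 addr0. Qed.

Lemma subspace_setT X : subspace_set [set: X]. Proof. by []. Qed.

Lemma linear_props X Y (T : X -> Y) : linear T ->
  [/\ T 0 = 0, (forall x y, T (x + y) = T x + T y),
      (forall x y, T (x - y) = T x - T y),
      (forall c x, T (c *: x) = c *: T x)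
    & forall (I : finType) (c : I -> K) (e : I -> X),
        T (\sum_i c i *: e i) = \sum_i c i *: T (e i)].
Proof.
move=> lT.
have D x y : T (x + y) = T x + T y by rewrite -[x]scale1r lT !scale1r.
have T0 : T 0 = 0 by apply: (addrI (T 0)); rewrite -D !addr0.
have Z c x : T (c *: x) = c *: T x by rewrite -[c *: x]addr0 lT T0 !addr0.
split=> //; first by move=> x y; rewrite D -scaleN1r Z scaleN1r.
move=> I c e; elim/big_ind2 : _ => //.
by move=> x1 x2 y1 y2 <- <-; rewrite D.
Qed.

Lemma subspace_ker X Y (T : X -> Y) : linear T -> subspace_set (ker_set T).
Proof.
move=> lT; have [T0 _ _ _ _] := linear_props lT; split=> // c x y.
by rewrite /ker_set /= => x0 y0; rewrite lT x0 y0 scaler0 addr0.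
Qed.

Lemma subspace_image X Y (T : X -> Y) (V : set X) :
  linear T -> subspace_set V -> subspace_set (T @` V).
Proof.
move=> lT sV; have [T0 _ _ _ _] := linear_props lT; split; first by exists 0 => //; exact: sV.1.
by move=> c _ _ [x Vx <-] [y Vy <-]; exists (c *: x + y); rewrite ?lT//; exact: sV.2.
Qed.

Lemma subspace_setI X (V W : set X) :
  subspace_set V -> subspace_set W -> subspace_set (V `&` W).
Proof.
move=> sV sW; split; first by split; [exact: sV.1|exact: sW.1].
by move=> c x y [? ?] [? ?]; split; [exact: sV.2|exact: sW.2].
Qed.

Definition sum_set X (V W : set X) : set X :=
  [set x | exists v w, [/\ V v, W w & x = v + w]].

Lemma subspace_sum_set X (V W : set X) :
  subspace_set V -> subspace_set W -> subspace_set (sum_set V W).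
Proof.
move=> sV sW; split; first by exists 0, 0; rewrite addr0; split=> //; [exact: sV.1|exact: sW.1].
move=> c _ _ [v [w [Vv Ww ->]]] [v' [w' [Vv' Ww' ->]]].
exists (c *: v + v'), (c *: w + w'); split; [exact: sV.2|exact: sW.2|].
by rewrite scalerDr addrACA.
Qed.

Definition indep_mod X (W : set X) m (e : 'I_m -> X) : Prop :=
  forall c : 'I_m -> K, W (\sum_i c i *: e i) -> forall i, c i = 0.

Definition span_mod X (V W : set X) m (e : 'I_m -> X) : Prop :=
  forall x, V x -> exists c : 'I_m -> K, W (x - \sum_i c i *: e i).

(** Exchange argument: with fewer than d spanning vectors, the matrix of
coordinates has a nonzero vector in its left kernel, which is a relation among the
independent vectors. *)
Lemma indep_le_span X (V W : set X) d d' (e : 'I_d -> X) (e' : 'I_d' -> X) :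
  subspace_set W -> (forall i, V (e i)) -> indep_mod W e -> span_mod V W e' ->
  (d <= d')%N.
Proof.
move=> sW eV eI eS; rewrite leqNgt; apply/negP => ltd.
have /choice [C CE] : forall i, exists c : 'I_d' -> K,
  W (e i - \sum_j c j *: e' j) by move=> i; exact: eS.
pose M : 'M[K]_(d, d') := \matrix_(i, j) C i j.
have : ~~ row_free M.
  by rewrite /row_free neq_ltn (leq_ltn_trans (rank_leq_col M)).
rewrite -kermx_eq0 => /rowV0Pn [v]; rewrite sub_kermx => /eqP vM v0.
have /eqP[] : v != 0 := v0.
apply/rowP => i; rewrite mxE; apply: (eI (fun i => v 0 i)).
have -> : \sum_i v 0 i *: e i = \sum_i v 0 i *: (e i - \sum_j C i j *: e' j).
  under [RHS]eq_bigr do rewrite scalerBr.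
  rewrite big_split /= -[LHS]addr0; congr (_ + _).
  rewrite sumrN; apply/esym/eqP; rewrite oppr_eq0; apply/eqP.
  under eq_bigr do rewrite scaler_sumr.
  rewrite exchange_big /= big1// => j _.
  have := congr1 (fun u : 'rV_d' => u 0 j) vM; rewrite !mxE => vj.
  rewrite -[RHS](scale0r (e' j)) -vj scaler_suml; apply: eq_bigr => k _.
  by rewrite mxE scalerA.
by apply: subspace_set_sum => // k; apply: subspace_setZ.
Qed.

Lemma has_quot_dim_uniq X (V W : set X) d d' : subspace_set W ->
  has_quot_dim V W d -> has_quot_dim V W d' -> d = d'.
Proof.
move=> sW [e [eV eI eS]] [e' [eV' eI' eS']]; apply/eqP; rewrite eqn_leq.
by rewrite (indep_le_span sW eV eI eS') (indep_le_span sW eV' eI' eS).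
Qed.

Lemma quot_dimP X (V W : set X) d : subspace_set W ->
  has_quot_dim V W d -> quot_dim V W = d.
Proof.
move=> sW h; apply: (@has_quot_dim_uniq X V W) => //; rewrite /quot_dim.
by apply: (@getPex _ [set d | has_quot_dim V W d]); exists d.
Qed.

Lemma sum_split X m (c : 'I_m.+1 -> K) (e : 'I_m.+1 -> X) :
  \sum_i c i *: e i
  = c ord0 *: e ord0 + \sum_i c (lift ord0 i) *: e (lift ord0 i).
Proof. by rewrite big_ord_recl. Qed.

(** A maximal independent family spans. This produces all the finite
dimensions below without any construction of quotient spaces. *)
Lemma bounded_indep_dim X (V W : set X) N : subspace_set W ->
  (forall m (e : 'I_m -> X), (forall i, V (e i)) -> indep_mod W e -> (m <= N)%N) ->
  finite_quot_dim V W.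
Proof.
move=> sW h.
pose P m := `[< exists e : 'I_m -> X, (forall i, V (e i)) /\ indep_mod W e >].
have exP : exists m, P m.
  exists 0%N; apply/asboolP; exists (fun=> 0); split; first by case.
  by move=> c _ [].
have PN m : P m -> (m <= N)%N by move=> /asboolP [e [? ?]]; exact: h.
case: (ex_maxnP exP PN) => m /asboolP [e [eV eI]] mmax.
exists m, e; split=> // x Vx; apply: contrapT => nx.
(* Otherwise x extends the family, in position 0. *)
have : P m.+1.
  apply/asboolP; exists (fun i => oapp e x (unlift ord0 i)); split.
    by move=> i; case: unliftP => [j|] _ //=.
  move=> c; rewrite sum_split unlift_none /=.
  under eq_bigr do rewrite liftK /=.
  move=> Wc.
  have c0 : c ord0 = 0.
    apply: contrapT => /eqP c0; apply: nx.
    exists (fun i => - ((c ord0)^-1 * c (lift ord0 i))).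
    have := subspace_setZ (c ord0)^-1 sW Wc.
    rewrite scalerDr scalerA mulVf// scale1r scaler_sumr -sumrN.
    by congr W; congr (_ + _); apply: eq_bigr => i _; rewrite scaleNr opprK scalerA.
  move: Wc; rewrite c0 scale0r add0r => /eI ce i.
  by case: (unliftP ord0 i) => [j ->|->].
by move=> /mmax; rewrite ltnn.
Qed.

Lemma span_finite_dim X (V W : set X) d (e : 'I_d -> X) : subspace_set W ->
  span_mod V W e -> finite_quot_dim V W.
Proof.
move=> sW eS; apply: (@bounded_indep_dim X V W d) => // m f fV fI.
exact: (indep_le_span sW fV fI eS).
Qed.

Lemma finite_quot_dim_sub X (U V W : set X) : subspace_set W ->
  V `<=` U -> finite_quot_dim U W -> finite_quot_dim V W.
Proof.
move=> sW VU [d [e [eV eI eS]]]; apply: (@span_finite_dim _ _ _ d e) => //.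
by move=> x /VU; exact: eS.
Qed.

Lemma finite_quot_dim_super X (U V W : set X) : subspace_set V ->
  W `<=` V -> finite_quot_dim U W -> finite_quot_dim U V.
Proof.
move=> sV WV [d [e [eV eI eS]]]; apply: (@span_finite_dim _ _ _ d e) => //.
by move=> x /eS [c /WV]; exists c.
Qed.

(** Concatenate a basis of [U / V] with one of [V / W]. *)
Lemma has_quot_dim_tower X (U V W : set X) m n :
  subspace_set U -> subspace_set V -> subspace_set W -> W `<=` V -> V `<=` U ->
  has_quot_dim U V m -> has_quot_dim V W n -> has_quot_dim U W (m + n).
Proof.
move=> sU sV sW WV VU [e [eU eI eS]] [f [fV fI fS]].
pose g (i : 'I_(m + n)) := match fintype.split i with inl j => e j | inr k => f k end.
have gE (c : 'I_(m + n) -> K) : \sum_i c i *: g i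
   = \sum_i c (lshift n i) *: e i + \sum_i c (rshift m i) *: f i.
  rewrite big_split_ord /=; congr (_ + _); apply: eq_bigr => i _.
    by rewrite /g (unsplitK (inl i)).
  by rewrite /g (unsplitK (inr i)).
exists g; split.
- by move=> i; rewrite /g; case: (fintype.split i) => j; [exact: eU|exact/VU/fV].
- move=> c; rewrite gE => Wc.
  have Vf : V (\sum_i c (rshift m i) *: f i).
    by apply: subspace_set_sum => // i; apply: subspace_setZ.
  have ce : forall i, c (lshift n i) = 0.
    by apply: eI; have := subspace_setB sV (WV _ Wc) Vf; rewrite addrK.
  have cf : forall i, c (rshift m i) = 0.
    apply: fI; move: Wc; rewrite big1 ?add0r// => i _.
    by rewrite ce scale0r.
  by move=> i; rewrite -(splitK i); case: (fintype.split i) => j /=.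
- move=> x Ux; have [c Vc] := eS _ Ux; have [b Wb] := fS _ Vc.
  exists (fun i => match fintype.split i with inl j => c j | inr k => b k end).
  rewrite gE opprD addrA.
  under eq_bigr do rewrite (unsplitK (inl _)).
  by under [X in _ - X]eq_bigr do rewrite (unsplitK (inr _)).
Qed.

Lemma has_quot_dim_image X Y (f : X -> Y) (V W : set X) d : linear f ->
  subspace_set V -> subspace_set W -> W `<=` V ->
  (forall x, V x -> f x = 0 -> W x) ->
  has_quot_dim V W d -> has_quot_dim (f @` V) (f @` W) d.
Proof.
move=> lf sV sW WV fW [e [eV eI eS]].
have [f0 fD fB fZ fS] := linear_props lf.
exists (f \o e); split.
- by move=> i; exists (e i).
- move=> c /=; rewrite -fS => -[w Ww /eqP].
  rewrite eq_sym -subr_eq0 -fB => /eqP h; apply: eI.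
  rewrite -[\sum_i _](subrK w); apply: subspace_setD => //; apply: fW => //.
  apply: subspace_setB => //; last exact: WV.
  by apply: subspace_set_sum => // i; apply: subspace_setZ.
- move=> _ [x Vx <-]; have [c Wc] := eS _ Vx; exists c => /=.
  by rewrite -fS -fB; exists (x - \sum_i c i *: e i).
Qed.

(** Second isomorphism theorem: a basis of V modulo its intersection with W is also a
basis of V + W modulo W. *)
Lemma has_quot_dim_second X (V W : set X) d : subspace_set V -> subspace_set W ->
  has_quot_dim V (V `&` W) d -> has_quot_dim (sum_set V W) W d.
Proof.
move=> sV sW [e [eV eI eS]]; exists e; split.
- by move=> i; exists (e i), 0; rewrite addr0; split=> //; exact: sW.1.
- move=> c Wc; apply: eI; split=> //.
  by apply: subspace_set_sum => // i; apply: subspace_setZ.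
- move=> _ [v [w [Vv Ww ->]]]; have [c [_ Wc]] := eS _ Vv; exists c.
  by rewrite addrAC; exact: subspace_setD.
Qed.

(** The index as a relation: it avoids any choice of dimension and makes
finiteness part of the assertion. *)
Definition has_index X Y (T : X -> Y) (k : int) : Prop :=
  exists a b, [/\ has_quot_dim (ker_set T) [set 0] a,
    has_quot_dim [set: Y] (range T) b & k = a%:Z - b%:Z].

Lemma has_index_uniq X Y (T : X -> Y) k l : linear T ->
  has_index T k -> has_index T l -> k = l.
Proof.
move=> lT [a [b [ha hb ->]]] [a' [b' [ha' hb' ->]]].
rewrite (has_quot_dim_uniq (@subspace_set0 X) ha ha').
by rewrite (has_quot_dim_uniq (subspace_image lT (@subspace_setT X)) hb hb').
Qed.

Lemma has_index_exists X Y (T : X -> Y) :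
  finite_quot_dim (ker_set T) [set 0] -> finite_quot_dim [set: Y] (range T) ->
  exists k, has_index T k.
Proof. by move=> [a ha] [b hb]; exists (a%:Z - b%:Z), a, b. Qed.

(** Additivity of the index. With I the intersection of [ker S] and [range T],
and J their sum, put p = dim I, q = dim (ker S / I) and r = codim J. Then
dim ker (S T) = dim ker T + p and dim ker S = q + p, while
codim range (S T) = codim range S + r and codim range T = r + q; q cancels in the
difference. *)
Lemma has_index_comp X Y Z (T : X -> Y) (S : Y -> Z) k l :
  linear T -> linear S -> has_index T k -> has_index S l ->
  has_index (S \o T) (k + l).
Proof.
move=> lT lS [a [b [ha hb kE]]] [c [d [hc hd lE]]].
have lST : linear (S \o T) by move=> t x y /=; rewrite lT lS.
have [T0 TD TB TZ _] := linear_props lT; have [S0 SD SB SZ _] := linear_props lS.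
have skT := subspace_ker lT; have skS := subspace_ker lS.
have skST := subspace_ker lST.
have srT : subspace_set (range T) := subspace_image lT (@subspace_setT X).
have srS : subspace_set (range S) := subspace_image lS (@subspace_setT Y).
have srST : subspace_set (range (S \o T)) := subspace_image lST (@subspace_setT X).
have s0Y := @subspace_set0 Y; have s0X := @subspace_set0 X.
pose I := ker_set S `&` range T.
have sI : subspace_set I by exact: subspace_setI.
pose J := sum_set (ker_set S) (range T).
have sJ : subspace_set J by exact: subspace_sum_set.
have [p hp] : finite_quot_dim I [set 0].
  by apply: (@finite_quot_dim_sub _ (ker_set S)) => //; [exact: subIsetl|exists c].
have [q hq] : finite_quot_dim (ker_set S) I.
  apply: (@finite_quot_dim_super _ _ _ [set 0]) => //; last by exists c.
  by move=> _ ->; exact: sI.1.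
have [r hr] : finite_quot_dim [set: Y] J.
  apply: (@finite_quot_dim_super _ _ _ (range T)) => //; last by exists b.
  by move=> y Ty; exists 0, y; rewrite add0r.
have cE : c = (q + p)%N.
  apply: (has_quot_dim_uniq s0Y hc).
  by apply: (has_quot_dim_tower _ _ _ _ _ hq hp) => //;
    [move=> _ ->; exact: sI.1|exact: subIsetl].
have bE : b = (r + q)%N.
  apply: (has_quot_dim_uniq srT hb).
  apply: (has_quot_dim_tower _ _ _ _ _ hr (has_quot_dim_second skS srT hq)) => //.
  by move=> y Ty; exists 0, y; rewrite add0r.
have TI : T @` ker_set (S \o T) = I.
  apply/seteqP; split.
    by move=> _ [x kx <-]; split=> //; exists x.
  by move=> y [ky [x _ xy]]; exists x => //; rewrite /ker_set /= xy.
have hker : has_quot_dim (ker_set (S \o T)) [set 0] (p + a).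
  apply: (@has_quot_dim_tower _ _ (ker_set T)) => //.
  - by move=> _ ->; exact: skT.1.
  - by move=> x; rewrite /ker_set /= => ->.
  have [p' hp'] : finite_quot_dim (ker_set (S \o T)) (ker_set T).
    move: hp => [e [eI eN eS]].
    have /choice [f fE] : forall i, exists x, ker_set (S \o T) x /\ T x = e i.
      move=> i; have := eI i; rewrite -TI => -[x kx xe]; by exists x.
    apply: (@span_finite_dim _ _ _ p f) => // x kx.
    have [|t tE] := eS (T x); first by rewrite -TI; exists x.
    exists t; rewrite /ker_set /= TB; have [_ _ _ _ ->] := linear_props lT.
    by rewrite -[RHS]tE; congr (_ - _); apply: eq_bigr => i _; rewrite (fE i).2.
  suff -> : p = p' by [].
  have kTS : ker_set T `<=` ker_set (S \o T).
    by move=> x; rewrite /ker_set /= => ->.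
  have := has_quot_dim_image lT skST skT kTS (fun x _ h => h) hp'.
  rewrite TI (_ : T @` ker_set T = [set 0]).
    by move=> /(has_quot_dim_uniq s0Y hp).
  apply/seteqP; split; first by move=> _ [x kx <-].
  by move=> _ ->; exists 0; [exact: skT.1|].
have hran : has_quot_dim [set: Z] (range (S \o T)) (d + r).
  apply: (@has_quot_dim_tower _ _ (range S)) => //.
    by move=> _ [x _ <-]; exists (T x).
  have := has_quot_dim_image lS (@subspace_setT Y) sJ _ _ hr.
  rewrite (_ : S @` J = range (S \o T)).
    apply=> // x _ Sx0; exists x, 0; rewrite addr0; split=> //; exact: srT.1.
  apply/seteqP; split.
    move=> _ [_ [v [w [Sv [x _ <-] ->]]] <-]; exists x => //=.
    by rewrite SD Sv add0r.
  move=> _ [x _ <-]; exists (T x) => //; exists 0, (T x); rewrite add0r; split=> //.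
by exists (p + a)%N, (d + r)%N; split=> //; lia.
Qed.

Lemma has_index_bij X Y (T : X -> Y) (S : Y -> X) : linear T ->
  cancel T S -> cancel S T -> has_index T 0.
Proof.
move=> lT TS ST; have [T0 _ _ _ _] := linear_props lT.
exists 0%N, 0%N; split=> //.
  exists (fun=> 0); split; [by case|by move=> c _ []|].
  move=> x kx; exists (fun=> 0); rewrite big_ord0 subr0 /=.
  by rewrite -[x]TS kx -T0 TS.
exists (fun=> 0); split; [by []|by move=> c _ []|].
by move=> x _; exists (fun=> 0); rewrite big_ord0 subr0; exists (S x).
Qed.

Lemma linear_inv X Y (T : X -> Y) (S : Y -> X) : linear T ->
  cancel T S -> cancel S T -> linear S.
Proof.
by move=> lT TS ST c x y; apply: (can_inj TS); rewrite ST lT !ST.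
Qed.

(** Conjugate operators have the same index, bijections having index 0. *)
Lemma has_index_conj X Y (U : X -> Y) (V : Y -> X) (T : X -> X) (S : Y -> Y) k :
  linear U -> linear T -> linear S -> cancel U V -> cancel V U ->
  (forall x, U (T x) = S (U x)) -> has_index S k -> has_index T k.
Proof.
move=> lU lT lS UV VU h hS.
have lV := linear_inv lU UV VU.
have -> : T = V \o (S \o U) by apply/funext => x /=; rewrite -h UV.
rewrite -[k]addr0; apply: has_index_comp => //; last exact: has_index_bij VU UV.
  by move=> c x y /=; rewrite lU lS.
rewrite -[k]add0r; apply: has_index_comp => //; exact: has_index_bij UV VU.
Qed.

Lemma sum_pairl X Y (I : finType) (c : I -> K) (e : I -> X) :
  \sum_i c i *: ((e i, 0) : X * Y) = (\sum_i c i *: e i, 0).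
Proof.
elim/big_rec2 : _ => // i x _ _ ->.
by apply: injective_projections; rewrite /= ?scaler0 ?addr0.
Qed.

(** Padding with an identity changes neither the kernel nor the cokernel. *)
Lemma has_index_prodl X Y (T : X -> X) k : linear T ->
  has_index T k -> has_index (fun z : X * Y => (T z.1, z.2)) k.
Proof.
move=> lT [a [b [[e [eV eI eS]] [f [fV fI fS]] ->]]]; exists a, b; split=> //.
- exists (fun i => (e i, 0)); split.
  + by move=> i; rewrite /ker_set /= eV.
  + by move=> c; rewrite sum_pairl => -[]; exact: eI.
  + move=> [x y] [/= Tx ->]; have [c cE] := eS _ Tx; exists c.
    by rewrite sum_pairl /= ; apply: injective_projections; rewrite //= subr0.
- exists (fun i => (f i, 0)); split=> //.
  + by move=> c; rewrite sum_pairl => -[[x y]] _ [/= Tx _]; apply: fI; exists x.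
  + move=> [x y] _; have [//|c [z _ zE]] := fS x; exists c.
    rewrite sum_pairl; exists (z, y) => //=; rewrite zE.
    by apply: injective_projections; rewrite //= subr0.
Qed.

(** T x S is the composite of T x 1 and 1 x S. *)
Lemma has_index_prod X Y (T : X -> X) (S : Y -> Y) k l :
  linear T -> linear S -> has_index T k -> has_index S l ->
  has_index (fun z : X * Y => (T z.1, S z.2)) (k + l).
Proof.
move=> lT lS hT hS.
have lP X' Y' (T' : X' -> X') : linear T' -> linear (fun z : X' * Y' => (T' z.1, z.2)).
  by move=> lT' c x y; apply: injective_projections; rewrite //= lT'.
have lQ : linear (fun z : X * Y => (z.1, S z.2)).
  by move=> c x y; apply: injective_projections; rewrite //= lS.
have := @has_index_comp _ _ _ _ _ _ _ (lP X Y T lT) lQ (has_index_prodl Y lT hT).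
apply; pose sw X' Y' (z : X' * Y') := (z.2, z.1).
apply: (@has_index_conj _ _ (sw X Y) (sw Y X) _ (fun z => (S z.1, z.2))) => //.
- exact: lP.
- by case.
- by case.
- exact: has_index_prodl.
Qed.

End LinearAlgebra.

(** * Real-valued norms and geometric convergence *)

Section GeometricCauchy.

Lemma half_expr_small (R : realType) (e : R) : 0 < e -> exists n, 2^-1 ^+ n < e.
Proof.
move=> e0; have [n _ /(_ n (leqnn n)) nP] := near_infty_natSinv_lt (PosNum e0).
exists n; apply: le_lt_trans nP.
rewrite exprVn lef_pV2 ?posrE ?exprn_gt0 ?ltr0n//.
by rewrite -natrX ler_nat ltn_expl.
Qed.

Lemma half_expr_smallM (R : realType) (C e : R) : 0 <= C -> 0 < e ->
  exists n, C * 2^-1 ^+ n < e.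
Proof.
move=> C0 e0; have C1 : 0 < C + 1 by lra.
have [n nP] := half_expr_small (divr_gt0 e0 C1); exists n.
move: nP; rewrite ltr_pdivlMr// mulrDr mulr1 mulrC; apply: le_lt_trans.
by rewrite lerDl exprn_ge0.
Qed.

Variables (K : numFieldType) (X : completeNormedModType K).
Hypothesis archi : forall e : K, 0 < e -> exists n, 2^-1 ^+ n < e.

(** Steps dominated by a geometric series give a Cauchy sequence; the bound on
the distance to the limit is what the constructions below use. It is stated for any
field with arbitrarily small powers of 1/2, to cover both the reals and the
complex numbers. *)
Lemma geometric_cauchy_limit (C : K) (x : nat -> X) : 0 <= C ->
  (forall n, `|x n.+1 - x n| <= C * 2^-1 ^+ n) ->
  exists s, forall n, `|s - x n| <= 2 * C * 2^-1 ^+ n.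
Proof.
move=> C0 xC.
have h0 n : 0 <= (2^-1 : K) ^+ n by rewrite exprn_ge0 // invr_ge0 ler0n.
have xk n k : `|x (n + k)%N - x n| <= 2 * C * (2^-1 ^+ n - 2^-1 ^+ (n + k)).
  elim: k => [|k IH]; first by rewrite addn0 !subrr normr0 mulr0.
  rewrite addnS -(subrKA (x (n + k)%N)).
  apply: (le_trans (ler_normD _ _)).
  apply: (le_trans (lerD (xC _) IH)).
  rewrite le_eqVlt; apply/orP; left; apply/eqP.
  by rewrite exprS mulrBr; field.
have xnm n m : (n <= m)%N -> `|x m - x n| <= 2 * C * 2^-1 ^+ n.
  move=> nm; rewrite -{1}(subnKC nm); apply: (le_trans (xk _ _)).
  by rewrite ler_wpM2l ?mulr_ge0// gerBl.
have arC e : 0 < e -> exists n, 2 * C * 2^-1 ^+ n < e.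
  move=> e0; have C1 : 0 < 2 * C + 1 by rewrite ltr_wpDl// mulr_ge0.
  have [n nP] := archi (divr_gt0 e0 C1); exists n.
  move: nP; rewrite ltr_pdivlMr// mulrDr mulr1 mulrC; apply: le_lt_trans.
  by rewrite lerDl.
have /cauchy_cvg /cvg_ex[s xs] : cauchy (x @ \oo).
  apply: cauchy_exP => e e0; have [n nP] := arC _ e0; exists (x n).
  exists n => // m /= /xnm; rewrite -ball_normE /ball_ /= distrC => h.
  exact: le_lt_trans h nP.
exists s => n; apply/ler_addgt0Pr => e e0.
move/cvgrPdist_lt : xs => /(_ _ e0) [N _ NP].
have := NP (maxn n N) (leq_maxr _ _) => h.
rewrite [leRHS]addrC -(subrKA (x (maxn n N))); apply: (le_trans (ler_normD _ _)).
by apply: lerD; [exact: (ltW h)|exact/xnm/leq_maxl].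
Qed.

End GeometricCauchy.

Section RealNorm.
Context {R : realType}.
Local Notation C := R[i].

(** The norms of the spaces at hand are complex numbers that happen to be real, and
the order of the complex numbers is partial; taking real parts gives access to the
linear order. *)
Definition rnorm (V : semiNormedZmodType C) (x : V) : R := complex.Re `|x|.

Lemma rnormE (V : semiNormedZmodType C) (x : V) : `|x| = (rnorm x)%:C%C.
Proof. by rewrite /rnorm RRe_real // normr_real. Qed.

Lemma rnorm_ge0 (V : semiNormedZmodType C) (x : V) : 0 <= rnorm x.
Proof. by rewrite -ler0c -rnormE. Qed.

Lemma rnormD (V : semiNormedZmodType C) (x y : V) : rnorm (x + y) <= rnorm x + rnorm y.
Proof. by rewrite -lecR rmorphD /= -!rnormE ler_normD. Qed.

Lemma rnormN (V : semiNormedZmodType C) (x : V) : rnorm (- x) = rnorm x.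
Proof. by rewrite /rnorm normrN. Qed.

Lemma rnormB (V : semiNormedZmodType C) (x y : V) : rnorm (x - y) <= rnorm x + rnorm y.
Proof. by rewrite -(rnormN y) rnormD. Qed.

Lemma rdistC (V : semiNormedZmodType C) (x y : V) : rnorm (x - y) = rnorm (y - x).
Proof. by rewrite /rnorm distrC. Qed.

Lemma rdist_triangle (V : semiNormedZmodType C) (y x z : V) :
  rnorm (x - z) <= rnorm (x - y) + rnorm (y - z).
Proof. by rewrite -(subrKA y); exact: rnormD. Qed.

Lemma rnorm0 (V : semiNormedZmodType C) : rnorm (0 : V) = 0.
Proof. by rewrite /rnorm normr0. Qed.

Lemma rnorm_eq0 (V : normedZmodType C) (x : V) : rnorm x = 0 -> x = 0.
Proof. by move=> x0; apply/eqP; rewrite -normr_eq0 rnormE x0. Qed.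

Lemma rnormZ (V : normedModType C) (c : C) (x : V) : rnorm (c *: x) = rnorm c * rnorm x.
Proof.
apply: (@complexI R); rewrite rmorphM /= -!rnormE; exact: normrZ.
Qed.

Lemma rnorm_real (c : R) : rnorm (c%:C)%C = `|c|.
Proof. by rewrite /rnorm normc_def /= expr0n /= addr0 sqrtr_sqr. Qed.

Lemma rnorm_half : rnorm (2^-1 : C) = 2^-1.
Proof.
have -> : (2^-1 : C) = (2^-1)%:C%C by rewrite fmorphV /= rmorph_nat.
by rewrite rnorm_real ger0_norm// invr_ge0 ler0n.
Qed.

Lemma rnorm_sum (V : semiNormedZmodType C) (I : finType) (f : I -> V) :
  rnorm (\sum_i f i) <= \sum_i rnorm (f i).
Proof.
elim/big_ind2 : _ => //; first by rewrite rnorm0.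
by move=> x1 x2 y1 y2 h1 h2; apply: le_trans (rnormD _ _) _; exact: lerD.
Qed.

Lemma rnorm_Re (c : C) : `|complex.Re c| <= rnorm c.
Proof. by rewrite -lecR -rnormE normc_ge_Re. Qed.

Lemma norm_imaginary_unit : `|'i%C : C| = 1.
Proof. by rewrite normc_def /= expr0n /= add0r expr1n sqrtr1. Qed.

Lemma rnorm_Im (c : C) : `|complex.Im c| <= rnorm c.
Proof.
have -> : complex.Im c = complex.Re (- (c * 'i%C)) by case: c => a b /=; ring.
apply: le_trans (rnorm_Re _) _.
by rewrite rnormN /rnorm normrM norm_imaginary_unit mulr1.
Qed.

Lemma rnorm_le_ReIm (c : C) : rnorm c <= `|complex.Re c| + `|complex.Im c|.
Proof.
rewrite {1}(complexE c); apply: le_trans (rnormD _ _) _.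
rewrite rnorm_real lerD2l {1}/rnorm normrM norm_imaginary_unit mul1r.
by rewrite -[leLHS]/(rnorm _) rnorm_real.
Qed.

Lemma half_exprC_small (e : C) : 0 < e -> exists n, 2^-1 ^+ n < e.
Proof.
move=> e0; have eR : e = (complex.Re e)%:C%C by rewrite RRe_real // gtr0_real.
have [|n nP] := @half_expr_small R (complex.Re e); first by move: e0; rewrite eR ltcR.
by exists n; rewrite eR -(rmorph_nat (real_complex R)) -fmorphV -rmorphXn ltcR.
Qed.

Lemma rnorm_limit (X : completeNormedModType C) (M : R) (x : nat -> X) : 0 <= M ->
  (forall n, rnorm (x n.+1 - x n) <= M * 2^-1 ^+ n) ->
  exists s, forall n, rnorm (s - x n) <= 2 * M * 2^-1 ^+ n.
Proof.
move=> M0 xM.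
have E n (a : R) : (a%:C * 2^-1 ^+ n = (a * 2^-1 ^+ n)%:C)%C.
  by rewrite rmorphM rmorphXn fmorphV rmorph_nat.
have [||s sP] := @geometric_cauchy_limit C X half_exprC_small (M%:C)%C x.
- by rewrite ler0c.
- by move=> n; rewrite rnormE E lecR.
exists s => n; have := sP n.
suff -> : 2 * (M%:C)%C * 2^-1 ^+ n = (2 * M * 2^-1 ^+ n)%:C%C.
  by rewrite rnormE lecR.
by rewrite !rmorphM rmorphXn fmorphV rmorph_nat.
Qed.

(** Completeness of the complex numbers, from that of the reals applied to the real and
imaginary parts. *)
Lemma scalar_limit (M : R) (x : nat -> C) : 0 <= M ->
  (forall n, rnorm (x n.+1 - x n) <= M * 2^-1 ^+ n) ->
  exists s, forall n, rnorm (s - x n) <= 4 * M * 2^-1 ^+ n.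
Proof.
move=> M0 xM.
have [||a aP] :=
    @geometric_cauchy_limit R R (@half_expr_small R) M (fun n => complex.Re (x n)) => //.
  move=> n; apply: le_trans (xM n); rewrite -raddfB; exact: rnorm_Re.
have [||b bP] :=
    @geometric_cauchy_limit R R (@half_expr_small R) M (fun n => complex.Im (x n)) => //.
  move=> n; apply: le_trans (xM n); rewrite -raddfB; exact: rnorm_Im.
exists (a +i* b)%C => n; apply: le_trans (rnorm_le_ReIm _) _.
have := lerD (aP n) (bP n); rewrite -mulrDl -mulrDl.
have -> : (2 + 2 : R) = 4 by ring.
by case: (x n).
Qed.

End RealNorm.

(** * Bounded and compact operators *)

Section BoundedCompact.
Context {R : realType}.
Local Notation C := R[i].
Implicit Types X Y Z : normedModType C.

Lemma bounded_opP X Y (T : X -> Y) : bounded_op T <->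
  linear T /\ exists M : R, 0 < M /\ forall x, rnorm (T x) <= M * rnorm x.
Proof.
split=> -[lT [M MT]]; split=> //.
  exists (rnorm M + 1); split; first by rewrite ltr_wpDl// rnorm_ge0.
  move=> x; have h : `|T x| <= `|M| * `|x|.
    have p : 0 <= M * `|x| by apply: le_trans (MT x).
    by have := MT x; rewrite -{1}(ger0_norm p) normrM normr_id.
  move: h; rewrite !rnormE -rmorphM lecR => /le_trans; apply.
  by rewrite mulrDl mul1r lerDl rnorm_ge0.
by exists (M%:C)%C => x; rewrite !rnormE -rmorphM lecR; exact: MT.2.
Qed.

Lemma rnorm_lt_nbhs X (x : X) (A : set X) :
  nbhs x A <-> exists e : R, 0 < e /\ forall y, rnorm (x - y) < e -> A y.
Proof.
split.
  move=> /nbhs_ballP[e /= e0 eA]; exists (complex.Re e); split.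
    by move: e0; rewrite ltcE /= => /andP[].
  move=> y xy; apply: eA; rewrite -ball_normE /ball_ /= rnormE.
  by rewrite -(RRe_real (gtr0_real e0)) ltcR.
move=> [e [e0 eA]]; apply/nbhs_ballP; exists (e%:C)%C => /=; first by rewrite ltcR.
move=> y; rewrite -ball_normE /ball_ /= rnormE ltcR; exact: eA.
Qed.

Lemma bounded_op_continuous X Y (T : X -> Y) : bounded_op T -> continuous T.
Proof.
move=> /bounded_opP[lT [M [M0 MT]]] x A /rnorm_lt_nbhs[e [e0 eA]].
apply/rnorm_lt_nbhs; exists (e / M); split; first exact: divr_gt0.
move=> y; rewrite ltr_pdivlMr// mulrC => xy; apply: eA.
by have [_ _ <- _ _] := linear_props lT; exact: le_lt_trans (MT _) _.
Qed.

Lemma compact_opP X Y (T : X -> Y) : compact_op T <->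
  exists D, compact D /\ forall x, rnorm x <= 1 -> D (T x).
Proof.
have E x : (`|x : X| <= 1) = (rnorm x <= 1).
  by rewrite rnormE -(rmorph1 (real_complex R)) lecR.
rewrite /compact_op precompactE; split.
  move=> cT; exists (closure (T @` [set x | `|x| <= 1])); split=> // x x1.
  by apply: subset_closure; exists x => //=; rewrite E.
move=> [D [cD DT]]; apply: (subclosed_compact (@closed_closure _ _) cD).
have clD : closed D by apply: compact_closed => //; exact: norm_hausdorff.
rewrite (closure_id D).1//; apply: closure_subset => _ [x x1 <-]; apply: DT.
by rewrite -E.
Qed.

Lemma compact_op0 X Y : compact_op (fun _ : X => 0 : Y).
Proof.
by apply/compact_opP; exists [set 0]; split=> //; exact: compact_set1.
Qed.

Lemma compact_opD X Y (S T : X -> Y) : compact_op S -> compact_op T ->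
  compact_op (fun x => S x + T x).
Proof.
move=> /compact_opP[D [cD DS]] /compact_opP[E [cE ET]]; apply/compact_opP.
exists ((fun z : Y * Y => z.1 + z.2) @` (D `*` E)); split.
  apply: continuous_compact; last exact: compact_setX.
  by apply: continuous_subspaceT => z; exact: add_continuous.
by move=> x x1; exists (S x, T x) => //; split; [exact: DS|exact: ET].
Qed.

Lemma compact_op_post X Y Z (T : X -> Y) (A : Y -> Z) : compact_op T ->
  bounded_op A -> compact_op (A \o T).
Proof.
move=> /compact_opP[D [cD DS]] bA; apply/compact_opP.
exists (A @` D); split.
  apply: continuous_compact => //; apply: continuous_subspaceT.
  exact: bounded_op_continuous.
by move=> x x1; exists (T x) => //; exact: DS.
Qed.

Lemma bounded_opZ X (c : C) : bounded_op (fun x : X => c *: x).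
Proof.
split; first by move=> a x y /=; rewrite scalerDr !scalerA mulrC.
by exists `|c| => x; rewrite normrZ.
Qed.

Lemma compact_op_pre X Y Z (T : Y -> Z) (A : X -> Y) : linear T -> compact_op T ->
  bounded_op A -> compact_op (T \o A).
Proof.
move=> lT cT /bounded_opP[lA [M [M0 MA]]].
have [_ _ _ TZ _] := linear_props lT.
have /compact_opP[D [cD DT]] := compact_op_post cT (@bounded_opZ Z (M%:C)%C).
apply/compact_opP; exists D; split=> // x x1.
have Mn0 : (M%:C)%C != 0 by rewrite -(rmorph0 (real_complex R)) (inj_eq (@complexI R)) gt_eqF.
have := DT ((M%:C)%C^-1 *: A x).
rewrite /= -TZ scalerA mulfV// scale1r; apply.
rewrite rnormZ -fmorphV rnorm_real gtr0_norm ?invr_gt0// mulrC ler_pdivrMr// mul1r.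
by apply: le_trans (MA x) _; rewrite ger_pMr.
Qed.

Lemma compact_op_sum X Y (I : finType) (T : I -> X -> Y) :
  (forall i, compact_op (T i)) -> compact_op (fun x => \sum_i T i x).
Proof.
move=> cT; rewrite (_ : (fun x => _) = \sum_i T i).
  elim/big_ind : _ => //; first exact: compact_op0.
  by move=> S S' cS cS'; exact: compact_opD.
by apply/funext => x; rewrite fct_sumE.
Qed.

(** The form in which compactness is used: images of bounded sequences have a cluster
point. The bound 2 is the one provided by [riesz_lemma]. *)
Lemma compact_op_cluster X Y (T : X -> Y) (x : nat -> X) : linear T -> compact_op T ->
  (forall n, rnorm (x n) <= 2) ->
  exists y, forall (e : R) N, 0 < e -> exists2 m, (N <= m)%N & rnorm (T (x m) - y) < e.
Proof.
move=> lT cT x2.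
have := compact_op_pre lT cT (@bounded_opZ X 2).
move=> /compact_opP[D [cD DT]].
have xD n : D (T (x n)).
  have := DT (2^-1 *: x n); rewrite /= scalerA mulfV ?scale1r; last by rewrite pnatr_eq0.
  by apply; rewrite rnormZ rnorm_half; have := x2 n; lra.
have [|y [Dy yc]] := cD (T \o x @ \oo) _; first by exists 0%N => // n _; exact: xD.
exists y => e N e0.
have /(_ _ _) := yc ((T \o x) @` [set n | (N <= n)%N]) [set z | rnorm (y - z) < e].
case.
- by exists N => // n /= Nn; exists n.
- by apply/rnorm_lt_nbhs; exists e.
by move=> _ [[n /= Nn <-]]; rewrite rdistC => ?; exists n.
Qed.

End BoundedCompact.

Section BoundedRing.
Context {R : realType}.
Local Notation C := R[i].

Section Def.
Variable X : completeNormedModType C.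

(** The bounded operators on X form a ring, in which the compact ones are an ideal; the
index computations are carried out there. *)
Record bop := Bop { bop_fun :> X -> X; bop_bounded : bounded_op bop_fun }.

Lemma bop_eq (S T : bop) : S =1 T -> S = T.
Proof.
case: S T => S bS [T bT] /= /funext ST; rewrite {}ST in bS *.
by rewrite (Prop_irrelevance bS bT).
Qed.

HB.instance Definition _ := gen_eqMixin bop.
HB.instance Definition _ := gen_choiceMixin bop.

Lemma bop_linear (T : bop) : linear T.
Proof. by case: T => T []. Qed.

HB.instance Definition _ (T : bop) := GRing.isLinear.Build C X X _ T (bop_linear T).

Lemma bop_bound (T : bop) : exists M : R, 0 < M /\ forall x, rnorm (T x) <= M * rnorm x.
Proof. by have /bounded_opP[] := bop_bounded T. Qed.

Fact bop0_subproof : bounded_op (fun _ : X => 0 : X).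
Proof.
split; first by move=> a x y; rewrite scaler0 addr0.
by exists 0 => x; rewrite normr0 mul0r.
Qed.

Fact bop1_subproof : bounded_op (fun x : X => x).
Proof. by split=> //; exists 1 => x; rewrite mul1r. Qed.

Fact bopD_subproof (S T : bop) : bounded_op (fun x : X => S x + T x).
Proof.
apply/bounded_opP; split; first by move=> a x y; rewrite !linearP scalerDr addrACA.
have [M [M0 MS]] := bop_bound S; have [N [N0 NT]] := bop_bound T.
exists (M + N); split=> [|x]; first exact: addr_gt0.
by apply: le_trans (rnormD _ _) _; rewrite mulrDl; exact: lerD.
Qed.

Fact bopN_subproof (T : bop) : bounded_op (fun x : X => - T x).
Proof.
split; first by move=> a x y; rewrite linearP opprD scalerN.
by case: T => T [lT [M MT]]; exists M => x /=; rewrite normrN.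
Qed.

Fact bopM_subproof (S T : bop) : bounded_op (fun x : X => S (T x)).
Proof.
apply/bounded_opP; split; first by move=> a x y; rewrite !linearP.
have [M [M0 MS]] := bop_bound S; have [N [N0 NT]] := bop_bound T.
exists (M * N); split=> [|x]; first exact: mulr_gt0.
by apply: le_trans (MS _) _; rewrite -mulrA ler_pM2l.
Qed.

Definition bop0 := Bop bop0_subproof.
Definition bop1 := Bop bop1_subproof.
Definition bopD S T := Bop (bopD_subproof S T).
Definition bopN T := Bop (bopN_subproof T).
Definition bopM S T := Bop (bopM_subproof S T).

Fact bopDA : associative bopD. Proof. by move=> *; apply: bop_eq => x; exact: addrA. Qed.
Fact bopDC : commutative bopD. Proof. by move=> *; apply: bop_eq => x; exact: addrC. Qed.
Fact bopD0 : left_id bop0 bopD. Proof. by move=> *; apply: bop_eq => x; exact: add0r. Qed.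
Fact bopDN : left_inverse bop0 bopN bopD.
Proof. by move=> *; apply: bop_eq => x; exact: addNr. Qed.
HB.instance Definition _ := GRing.isZmodule.Build bop bopDA bopDC bopD0 bopDN.

Fact bopMA : associative bopM. Proof. by move=> *; exact: bop_eq. Qed.
Fact bop1M : left_id bop1 bopM. Proof. by move=> *; exact: bop_eq. Qed.
Fact bopM1 : right_id bop1 bopM. Proof. by move=> *; exact: bop_eq. Qed.
Fact bopMDl : left_distributive bopM bopD. Proof. by move=> *; exact: bop_eq. Qed.
Fact bopMDr : right_distributive bopM bopD.
Proof. by move=> *; apply: bop_eq => x /=; rewrite linearD. Qed.
HB.instance Definition _ := GRing.Zmodule_isPzRing.Build bop bopMA bop1M bopM1 bopMDl bopMDr.

Lemma bop0E x : (0 : bop) x = 0. Proof. by []. Qed.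
Lemma bop1E x : (1 : bop) x = x. Proof. by []. Qed.
Lemma bopDE (S T : bop) x : (S + T) x = S x + T x. Proof. by []. Qed.
Lemma bopNE (T : bop) x : (- T) x = - T x. Proof. by []. Qed.
Lemma bopBE (S T : bop) x : (S - T) x = S x - T x. Proof. by []. Qed.
Lemma bopME (S T : bop) x : (S * T) x = S (T x). Proof. by []. Qed.
Definition bopE := (bop0E, bop1E, bopDE, bopBE, bopNE, bopME).

Lemma bop_sumE (I : finType) (f : I -> bop) x : (\sum_i f i) x = \sum_i f i x.
Proof. by elim/big_rec2 : _ => // i y z _ <-. Qed.

Definition cbop (T : bop) : Prop := compact_op T.

End Def.

Definition ideal_set (S : pzRingType) (I : S -> Prop) : Prop :=
  [/\ I 0, forall a b, I a -> I b -> I (a + b),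
      forall a b, I b -> I (a * b) & forall a b, I a -> I (a * b)].

Lemma cbop_ideal X : ideal_set (@cbop X).
Proof.
split.
- exact: compact_op0.
- by move=> S T; exact: compact_opD.
- by move=> S T cT; apply: (compact_op_post cT); exact: bop_bounded.
- move=> S T cS; apply: (compact_op_pre (bop_linear S) cS); exact: bop_bounded.
Qed.

End BoundedRing.
Arguments bop {R} X.

(** * Riesz theory: finite kernels and closed ranges *)

Section Riesz.
Context {R : realType}.
Local Notation C := R[i].
Variable X : completeNormedModType C.
Implicit Types (T K : bop X) (W V : set X).

Lemma subrACA (V : zmodType) (x y z t : V) : (x - y) - (z - t) = (x - z) - (y - t).
Proof. by rewrite opprD addrACA -opprD. Qed.

Definition adherent W (x : X) : Prop :=
  forall e : R, 0 < e -> exists2 w, W w & rnorm (x - w) < e.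

Definition norm_closed W : Prop := forall x, adherent W x -> W x.

Lemma bopxD T x y : T (x + y) = T x + T y.
Proof. exact: linearD. Qed.
Lemma bopxB T x y : T (x - y) = T x - T y.
Proof. exact: linearB. Qed.
Lemma bopxZ T c x : T (c *: x) = c *: T x.
Proof. exact: linearZ. Qed.
Lemma bopx0 T : T 0 = 0.
Proof. exact: linear0. Qed.

Lemma rnorm_small_eq0 (V : normedModType C) (x : V) :
  (forall e : R, 0 < e -> rnorm x < e) -> x = 0.
Proof.
move=> h; apply: rnorm_eq0; apply/eqP; rewrite eq_le rnorm_ge0 andbT leNgt.
by apply/negP => /h; rewrite ltxx.
Qed.

Lemma natSinv_small (e : R) : 0 < e -> exists N, forall n, (N <= n)%N -> n.+1%:R^-1 < e.
Proof. by move=> e0; have [N _ NP] := near_infty_natSinv_lt (PosNum e0); exists N. Qed.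

Lemma norm_closed_ker T : norm_closed (ker_set T).
Proof.
move=> x ax; apply: rnorm_small_eq0 => e e0.
have [M [M0 MT]] := bop_bound T.
have [|w] := ax (e / M); first exact: divr_gt0.
rewrite /ker_set /= => Tw; rewrite ltr_pdivlMr// mulrC => h.
by have := le_lt_trans (MT _) h; rewrite linearB /= Tw subr0.
Qed.

(** Riesz lemma: rescale [x - w0], where w0 in W is at most twice as far from x as
W is. The vector obtained is recorded as [a *: (x - w0)] because properties of x that
are invariant under scaling and under translations by W are then inherited. *)
Lemma riesz_lemma W x : subspace_set W -> norm_closed W -> ~ W x ->
  exists (a : C) (w0 : X), [/\ a != 0, W w0, rnorm (a *: (x - w0)) <= 2 &
    forall w, W w -> 1 <= rnorm (a *: (x - w0) - w)].
Proof.
move=> sW cW nWx.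
have [e0 [e00 e0P]] : exists e : R, 0 < e /\ forall w, W w -> e <= rnorm (x - w).
  apply: contrapT => h; apply/nWx/cW => e e0.
  apply: contrapT => h'; apply: h; exists e; split=> // w Ww.
  by rewrite leNgt; apply/negP => xw; apply: h'; exists w.
pose E := [set rnorm (x - w) | w in W].
have infE : has_inf E.
  split; first by exists (rnorm (x - 0)), 0 => //; exact: sW.1.
  by exists e0 => _ [w Ww <-]; exact: e0P.
pose d := inf E.
have d0 : 0 < d.
  apply: (lt_le_trans e00); apply: lb_le_inf; first exact: infE.1.
  by move=> _ [w Ww <-]; exact: e0P.
have dP w : W w -> d <= rnorm (x - w).
  by move=> Ww; apply: ge_inf; [exact: infE.2|exists w].
have [_ [w0 Ww0 <-] w0d] := inf_adherent d0 infE.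
have dn : rnorm (d^-1%:C)%C = d^-1 :> R by rewrite rnorm_real gtr0_norm ?invr_gt0.
have dC0 : (d%:C)%C != 0 :> C.
  by rewrite -(rmorph0 (real_complex R)) (inj_eq (@complexI R)) gt_eqF.
exists (d^-1%:C)%C, w0; split=> //.
- by rewrite fmorphV invr_eq0.
- rewrite rnormZ dn mulrC ler_pdivrMr//; apply/ltW; apply: lt_le_trans w0d _.
  by rewrite -/d; lra.
- move=> w Ww.
  have -> : (d^-1%:C)%C *: (x - w0) - w = (d^-1%:C)%C *: (x - (w0 + (d%:C)%C *: w)).
    by rewrite opprD addrA [RHS]scalerBr scalerA fmorphV mulVf// scale1r.
  rewrite rnormZ dn mulrC ler_pdivlMr// mul1r; apply: dP.
  by apply: subspace_setD => //; exact: subspace_setZ.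
Qed.

(** Two terms of the image sequence that are within 1/2 of a cluster point are at
distance less than 1 of one another. *)
Lemma no_separated_sequence K (x : nat -> X) : cbop K ->
  (forall n, rnorm (x n) <= 2) ->
  (forall m n, (m < n)%N -> 1 <= rnorm (K (x n) - K (x m))) -> False.
Proof.
move=> cK x2 sep.
have [y yP] := compact_op_cluster (bop_linear K) cK x2.
have h : 0 < 2^-1 :> R by lra.
have [m _ hm] := yP _ 0%N h; have [n mn hn] := yP _ m.+1 h.
have := sep _ _ mn; rewrite leNgt => /negP; apply.
apply: le_lt_trans (rdist_triangle y _ _) _; rewrite (rdistC y); lra.
Qed.

Definition line_sum W (v : X) : set X := [set x | exists t : C, W (x - t *: v)].

Lemma subspace_line_sum W v : subspace_set W -> subspace_set (line_sum W v).
Proof.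
move=> sW; split; first by exists 0; rewrite scale0r subr0; exact: sW.1.
move=> c x y [t Wt] [s Ws]; exists (c * t + s).
have -> : c *: x + y - (c * t + s) *: v = c *: (x - t *: v) + (y - s *: v).
  by rewrite scalerBr scalerDl opprD scalerA addrACA.
exact: sW.2.
Qed.

(** Adding a line to a closed subspace W keeps it closed. If v is at distance at least
d from W, then d |t| is at most the norm of [t v - w], so that the coefficients along
v of a convergent sequence in W + C v form a Cauchy sequence. *)
Lemma closed_line_sum W v : subspace_set W -> norm_closed W ->
  norm_closed (line_sum W v).
Proof.
move=> sW cW; have [Wv|nWv] := pselect (W v).
  move=> x ax; exists 0; rewrite scale0r subr0; apply: cW => e e0.
  have [w [t Wt] xw] := ax e e0; exists w => //.
  by rewrite -(subrK (t *: v) w); apply: subspace_setD => //; exact: subspace_setZ.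
have [e0 [e00 e0P]] : exists e : R, 0 < e /\ forall w, W w -> e <= rnorm (v - w).
  apply: contrapT => h; apply/nWv/cW => e e0.
  apply: contrapT => h'; apply: h; exists e; split=> // w Ww.
  by rewrite leNgt; apply/negP => xw; apply: h'; exists w.
have tP t w : W w -> e0 * rnorm t <= rnorm (t *: v - w).
  move=> Ww; have [->|t0] := eqVneq t 0; first by rewrite rnorm0 mulr0 rnorm_ge0.
  rewrite -[w](@scalerKV _ _ t t0) -scalerBr rnormZ mulrC ler_wpM2l ?rnorm_ge0//.
  by apply: e0P; exact: subspace_setZ.
move=> x ax.
have h2 n : 0 < (2^-1 : R) ^+ n by rewrite exprn_gt0.
have /choice [t tE] : forall n, exists t : C,
    exists2 w, W w & rnorm (x - t *: v - w) < 2^-1 ^+ n.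
  move=> n; have [w [t Wt] xw] := ax _ (h2 n).
  by exists t, (w - t *: v) => //; rewrite opprB addrA subrK.
have tn n : rnorm (t n.+1 - t n) <= 2 / e0 * 2^-1 ^+ n.
  have [w Ww xw] := tE n; have [w' Ww' xw'] := tE n.+1.
  rewrite mulrAC ler_pdivlMr// mulrC.
  have := tP (t n.+1 - t n) (w - w') (subspace_setB sW Ww Ww').
  move/le_trans; apply.
  have -> : (t n.+1 - t n) *: v - (w - w') =
     (x - t n *: v - w) - (x - t n.+1 *: v - w').
    by rewrite [RHS]subrACA (subrACA x) subrr sub0r opprB scalerBl.
  apply: le_trans (rnormB _ _) _.
  have -> : 2 * 2^-1 ^+ n = 2^-1 ^+ n + 2^-1 ^+ n :> R by ring.
  apply: lerD; apply/ltW => //; apply: (lt_le_trans xw').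
  by rewrite exprS ler_piMl ?(ltW (h2 n))//; lra.
have [|s sP] := @scalar_limit R (2 / e0) t _ tn.
  by rewrite divr_ge0 // ltW.
exists s; apply: cW => e e1.
have [n nP] := @half_expr_smallM R (4 * (2 / e0) * rnorm v + 1) e
  ltac:(rewrite addr_ge0// mulr_ge0 ?rnorm_ge0// mulr_ge0// divr_ge0// ltW//) e1.
have [w Ww xw] := tE n; exists w => //; apply: le_lt_trans nP.
have -> : x - s *: v - w = (x - t n *: v - w) - (s - t n) *: v.
  by rewrite scalerBl [RHS]addrAC opprB addrA subrK.
apply: le_trans (rnormB _ _) _; rewrite mulrDl mul1r addrC lerD//; last exact: ltW.
by rewrite rnormZ mulrAC ler_wpM2r ?rnorm_ge0.
Qed.

Fixpoint span_seq (s : seq X) : set X :=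
  if s is v :: s' then line_sum (span_seq s') v else [set 0].

Lemma subspace_span_seq s : subspace_set (span_seq s).
Proof. by elim: s => [|v s IH]; [exact: subspace_set0|exact: subspace_line_sum]. Qed.

Lemma closed_span_seq s : norm_closed (span_seq s).
Proof.
elim: s => [|v s IH] /=.
  move=> x ax; apply: rnorm_small_eq0 => e e0; have [_ -> ] := ax e e0.
  by rewrite subr0.
apply: closed_line_sum => //; exact: subspace_span_seq.
Qed.

Lemma mem_span_seq s x : x \in s -> span_seq s x.
Proof.
elim: s => //= v s IH; rewrite inE => /orP[/eqP ->|/IH xs].
  by exists 1; rewrite scale1r subrr; exact: (subspace_span_seq s).1.
by exists 0; rewrite scale0r subr0.
Qed.

Lemma span_seq_sum s x : span_seq s x ->
  exists c : 'I_(size s) -> C, x = \sum_i c i *: s`_i.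
Proof.
elim: s x => [x ->|v s IH x [t /IH [c cE]]] /=.
  by exists (fun=> 0); rewrite big_ord0.
exists (fun i => oapp c t (unlift ord0 i)).
rewrite big_ord_recl unlift_none /= -(subrK (t *: v) x) cE addrC; congr (_ + _).
by apply: eq_bigr => i _; rewrite liftK.
Qed.

Lemma not_finite_dim_outside V (s : seq X) :
  ~ finite_quot_dim V [set 0] -> exists2 x, V x & ~ span_seq s x.
Proof.
move=> nV; apply: contrapT => h; apply: nV.
apply: (@span_finite_dim _ _ _ _ (size s) (fun i => s`_i)); first exact: subspace_set0.
move=> x Vx; have [sx|nsx] := pselect (span_seq s x); last by exfalso; apply: h; exists x.
have [c cE] := span_seq_sum sx; exists c; rewrite -cE; exact: subrr.
Qed.

Section OneMinusCompact.
Variable K : bop X.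
Hypothesis cK : cbop K.
Local Notation T := (1 - K).

Lemma one_minusE x : K x = x - T x.
Proof. by rewrite !bopE opprB addrC subrK. Qed.

(** On the kernel of 1 - K the operator K is the identity. In an infinite-dimensional
kernel, the Riesz lemma applied to spans of finitely many vectors yields an infinite
sequence of vectors at mutual distances at least 1, which K fixes. *)
Lemma finite_dim_ker : finite_quot_dim (ker_set T) [set 0].
Proof.
apply: contrapT => nfin.
have skT : subspace_set (ker_set T) := subspace_ker (bop_linear T).
have /choice [f fP] : forall s : seq X, exists v : X,
    (forall w, w \in s -> ker_set T w) ->
    [/\ ker_set T v, rnorm v <= 2 & forall w, w \in s -> 1 <= rnorm (v - w)].
  move=> s; have [sk|nsk] := pselect (forall w, w \in s -> ker_set T w); last by exists 0.
  have [x kx nsx] := not_finite_dim_outside s nfin.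
  have [a [w0 [a0 sw0 h2 hd]]] := riesz_lemma (subspace_span_seq s) (@closed_span_seq s) nsx.
  have kw0 : ker_set T w0.
    have [c ->] := span_seq_sum sw0; apply: subspace_set_sum => // i.
    by apply: subspace_setZ => //; apply: sk; exact: mem_nth.
  exists (a *: (x - w0)) => _; split=> //.
    by apply: subspace_setZ => //; exact: subspace_setB.
  by move=> w /mem_span_seq; exact: hd.
(* The n-th vector chosen is [f (s n)], and [s n] lists the previous ones. *)
pose s n := iter n (fun s => f s :: s) [::].
have sk n w : w \in s n -> ker_set T w.
  elim: n w => //= n IH w; rewrite inE => /orP[/eqP ->|/IH//].
  by have [] := fP (s n) IH.
apply: (@no_separated_sequence K (f \o s) cK).
  by move=> n; have [] := fP (s n) (sk n).
move=> m n mn /=.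
have fs k : K (f (s k)) = f (s k).
  have [+ _ _] := fP (s k) (sk k); rewrite one_minusE /ker_set /= => ->.
  by rewrite subr0.
rewrite !fs; have [_ _] := fP (s n) (sk n); apply.
elim: n mn {fs} => // n IH; rewrite ltnS leq_eqVlt => /orP[/eqP ->|/IH h].
  exact: mem_head.
by rewrite /= inE h orbT.
Qed.

(** Otherwise the Riesz lemma gives vectors v of norm at most 2 and at distance at least
1 from the kernel, with T v tending to 0. As v = T v + K v, a cluster point of the K v
is a cluster point of the v; it lies in the kernel, a contradiction. *)
Lemma ker_dist_bound : exists2 c : R, 0 < c &
  forall x, exists2 z, ker_set T z & rnorm (x - z) <= c * rnorm (T x).
Proof.
apply: contrapT => h.
have skT : subspace_set (ker_set T) := subspace_ker (bop_linear T).
have /choice [v vP] : forall n, exists v : X, [/\ rnorm v <= 2,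
    forall z, ker_set T z -> 1 <= rnorm (v - z) & n.+1%:R * rnorm (T v) <= 2].
  move=> n.
  have [x xP] : exists x, forall z, ker_set T z -> n.+1%:R * rnorm (T x) < rnorm (x - z).
    apply: contrapT => h'; apply: h; exists n.+1%:R => // x.
    apply: contrapT => h''; apply: h'; exists x => z kz; rewrite ltNge.
    by apply/negP => ?; apply: h''; exists z.
  have nkx : ~ ker_set T x.
    by move=> /[dup] kx /xP; rewrite subrr rnorm0 ltNge mulr_ge0 ?rnorm_ge0.
  have [a [w0 [a0 kw0 h2 hd]]] := riesz_lemma skT (@norm_closed_ker T) nkx.
  exists (a *: (x - w0)); split=> //; apply: le_trans h2.
  rewrite bopxZ bopxB (kw0 : T w0 = 0) subr0 !rnormZ mulrCA.
  by rewrite ler_wpM2l ?rnorm_ge0// ltW// xP.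
have v2 n : rnorm (v n) <= 2 by have [] := vP n.
have [y yP] := compact_op_cluster (bop_linear K) cK v2.
have Tv (e : R) : 0 < e -> exists N, forall n, (N <= n)%N -> rnorm (T (v n)) < e.
  move=> e0; have [|N NP] := @natSinv_small (e / 2); first by lra.
  exists N => n /NP; rewrite invf_plt ?posrE ?divr_gt0// => hn.
  have [_ _] := vP n; rewrite mulrC -ler_pdivlMr// => /le_lt_trans; apply.
  rewrite ltr_pdivrMr// mulrC -ltr_pdivrMr//.
  by move: hn; rewrite invf_div.
have vy (e : R) : 0 < e -> exists n, rnorm (v n - y) < e /\ rnorm (T (v n)) < e.
  move=> e0; have e2 : 0 < e / 2 by lra.
  have [N NP] := Tv _ e2; have [m Nm hm] := yP _ N e2.
  exists m; split; last by apply: lt_trans (NP _ Nm) _; lra.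
  have -> : v m - y = T (v m) + (K (v m) - y) by rewrite one_minusE addrA (addrC (T _)) subrK.
  by apply: le_lt_trans (rnormD _ _) _; have := NP _ Nm; lra.
have ky : ker_set T y.
  apply: rnorm_small_eq0 => e e0; have [M [M0 MT]] := bop_bound T.
  have d0 : 0 < e / (M + 1) by rewrite divr_gt0// addr_gt0.
  have [n [n1 n2]] := vy _ d0.
  have -> : T y = T (v n) - T (v n - y) by rewrite bopxB opprB addrCA subrr addr0.
  apply: le_lt_trans (rnormB _ _) _.
  apply: le_lt_trans (lerD (lexx _) (MT _)) _.
  have -> : e = e / (M + 1) + M * (e / (M + 1)) by field; rewrite gt_eqF// addr_gt0.
  by apply: ltrD => //; rewrite ltr_pM2l.
have [n [n1 _]] := vy 1 ltr01.
by have [_ /(_ _ ky) + _] := vP n; rewrite leNgt n1.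
Qed.

(** If T x_n converges to y rapidly, [ker_dist_bound] allows to change the steps
x_(n+1) - x_n by elements of the kernel so that they become summable; T maps their
sum to y - T x_0. *)
Lemma closed_range : norm_closed (range T).
Proof.
move=> y ay; have [c c0 cP] := ker_dist_bound.
have h2 n : 0 < (2^-1 : R) ^+ n by rewrite exprn_gt0.
have /choice [x xP] : forall n, exists x, rnorm (y - T x) < 2^-1 ^+ n.
  by move=> n; have [_ [x _ <-] xy] := ay _ (h2 n); exists x.
have /choice [w wP] : forall n, exists w, T w = T (x n.+1 - x n) /\
    rnorm w <= c * rnorm (T (x n.+1 - x n)).
  move=> n; have [z kz zP] := cP (x n.+1 - x n); exists (x n.+1 - x n - z).
  by rewrite bopxB (kz : T z = 0) subr0.
pose S n := \sum_(i < n) w i.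
have TS n : T (S n) = T (x n) - T (x 0%N).
  elim: n => [|n IH]; first by rewrite /S big_ord0 bopx0 subrr.
  by rewrite /S big_ord_recr bopxD IH (wP n).1 bopxB [LHS]addrC subrKA.
have [||s sP] := @rnorm_limit R X (c * 2) S; first by rewrite mulr_ge0// ltW.
  move=> n; rewrite /S big_ord_recr /= addrAC subrr add0r.
  apply: le_trans (wP n).2 _; rewrite -mulrA ler_wpM2l ?ltW//.
  rewrite bopxB; apply: le_lt_trans (rdist_triangle y _ _) _; rewrite rdistC.
  by have := xP n; have := xP n.+1; have := h2 n; rewrite exprS; lra.
exists (s + x 0%N) => //; apply/eqP; rewrite eq_sym -subr_eq0; apply/eqP.
apply: rnorm_small_eq0 => e e0; have [M [M0 MT]] := bop_bound T.
have [n nP] := @half_expr_smallM R (1 + M * (2 * (c * 2))) e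
  ltac:(rewrite addr_ge0// mulr_ge0 ?mulr_ge0// ltW//) e0.
apply: le_lt_trans nP.
have -> : y - T (s + x 0%N) = (y - T (x n)) - T (s - S n).
  rewrite bopxB TS bopxD; move: (T s) (T (x n)) (T (x 0%N)) => a b d.
  by rewrite opprB [RHS]addrA subrKA opprD addrA addrAC.
apply: le_trans (rnormB _ _) _; rewrite mulrDl mul1r lerD//; first exact: ltW.
by apply: le_trans (MT _) _; rewrite -mulrA ler_pM2l.
Qed.

End OneMinusCompact.

End Riesz.

(** * Index zero of compact perturbations of the identity, and stability of the index *)

Section RieszIndex.
Context {R : realType}.
Local Notation C := R[i].
Variable X : completeNormedModType C.

Section OneMinusCompact.
Variables K T : bop X.
Hypotheses (cK : cbop K) (TE : T = 1 - K).

Lemma one_minus_compact_expr n : exists2 L, cbop L & T ^+ n = 1 - L.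
Proof.
have [c0 cD cl cr] := cbop_ideal X.
elim: n => [|n [L cL TL]]; first by exists 0; rewrite ?subr0.
exists (K + T * L); first by apply: cD => //; exact: cl.
by rewrite exprS TL mulrBr mulr1 {1}TE opprD addrA.
Qed.

Lemma subspace_ker_bop (S : bop X) : subspace_set (ker_set S).
Proof. exact: subspace_ker (bop_linear S). Qed.

Lemma subspace_range_bop (S : bop X) : subspace_set (range S).
Proof. exact: subspace_image (bop_linear S) (@subspace_setT _ X). Qed.

Lemma ker_expr_mono m n : (m <= n)%N -> ker_set (T ^+ m) `<=` ker_set (T ^+ n).
Proof.
move=> /subnK <- x; rewrite /ker_set /= exprD bopME => ->; exact: bopx0.
Qed.

Lemma range_expr_mono m n : (m <= n)%N -> range (T ^+ n) `<=` range (T ^+ m).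
Proof. by move=> /subnKC <- _ [x _ <-]; rewrite exprD bopME; exists ((T ^+ (n - m)) x). Qed.

(** If the kernels of the powers of T grew strictly, the Riesz lemma would give v_n in
ker T^(n+1) at distance at least 1 from ker T^n, and for m < n the difference
K v_n - K v_m is v_n plus an element of ker T^n. *)
Lemma ker_chain_stable : exists p, forall n, ker_set (T ^+ n) `<=` ker_set (T ^+ p).
Proof.
have [[p pP]|h] := pselect (exists p, ker_set (T ^+ p.+1) `<=` ker_set (T ^+ p)).
  exists p; elim => [|n IH]; first exact: ker_expr_mono.
  move=> x; rewrite /ker_set /= exprSr bopME => /IH.
  by rewrite /ker_set /= -bopME -exprSr => /pP.
exfalso.
have /choice [v vP] : forall n, exists v : X, [/\ ker_set (T ^+ n.+1) v, rnorm v <= 2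
    & forall w, ker_set (T ^+ n) w -> 1 <= rnorm (v - w)].
  move=> n.
  have [x kx nkx] : exists2 x, ker_set (T ^+ n.+1) x & ~ ker_set (T ^+ n) x.
    apply: contrapT => h'; apply: h; exists n => x kx; apply: contrapT => nkx.
    by apply: h'; exists x.
  have [a [w [a0 kw h2 hd]]] :=
    riesz_lemma (subspace_ker_bop _) (@norm_closed_ker _ _ (T ^+ n)) nkx.
  exists (a *: (x - w)); split=> //.
  apply: subspace_setZ; first exact: subspace_ker_bop.
  apply: subspace_setB => //; first exact: subspace_ker_bop.
  exact: (ker_expr_mono (leqnSn n)).
apply: (@no_separated_sequence _ _ K v cK); first by move=> n; have [] := vP n.
move=> m n mn; rewrite !(one_minusE K) -TE.
have -> : v n - T (v n) - (v m - T (v m)) = v n - (T (v n) + (v m - T (v m))).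
  by rewrite [in RHS]opprD addrA.
have [kn _ dn] := vP n; have [km _ _] := vP m; apply: dn.
have sk := subspace_ker_bop (T ^+ n).
have kmn : ker_set (T ^+ n) (v m) by apply: (ker_expr_mono mn).
apply: subspace_setD => //; first by move: kn; rewrite /ker_set /= exprSr bopME.
apply: subspace_setB => //.
by rewrite /ker_set /= -bopME -exprSr exprS bopME (kmn : _ = 0) bopx0.
Qed.

(** Dual to [ker_chain_stable], with the ranges of the powers of T, which are closed
because these powers are again of the form 1 - L with L compact. *)
Lemma range_chain_stable : exists p, forall n, range (T ^+ p) `<=` range (T ^+ n).
Proof.
have [[p pP]|h] := pselect (exists p, range (T ^+ p) `<=` range (T ^+ p.+1)).
  exists p; elim => [|n IH]; first exact: range_expr_mono.
  move=> y /pP [x _ <-].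
  have [z _ zx] := IH (((T ^+ p) x)) (ex_intro2 _ _ x I erefl).
  by exists z => //; rewrite exprS bopME zx -bopME -exprS.
exfalso.
have /choice [v vP] : forall n, exists v : X, [/\ range (T ^+ n) v, rnorm v <= 2
    & forall w, range (T ^+ n.+1) w -> 1 <= rnorm (v - w)].
  move=> n.
  have [x kx nkx] : exists2 x, range (T ^+ n) x & ~ range (T ^+ n.+1) x.
    apply: contrapT => h'; apply: h; exists n => x kx; apply: contrapT => nkx.
    by apply: h'; exists x.
  have clr : norm_closed (range (T ^+ n.+1)).
    by have [L cL ->] := one_minus_compact_expr n.+1; exact: closed_range.
  have [a [w [a0 kw h2 hd]]] := riesz_lemma (subspace_range_bop _) clr nkx.
  exists (a *: (x - w)); split=> //.
  apply: subspace_setZ; first exact: subspace_range_bop.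
  apply: subspace_setB => //; first exact: subspace_range_bop.
  exact: (range_expr_mono (leqnSn n)).
have shift m n x : (m <= n)%N -> range (T ^+ n) x -> range (T ^+ m.+1) (T x).
  move=> mn [y _ <-]; rewrite -bopME -exprS; apply: (@range_expr_mono m.+1 n.+1 mn).
  by exists y.
apply: (@no_separated_sequence _ _ K v cK); first by move=> n; have [] := vP n.
move=> m n mn; rewrite rdistC !(one_minusE K) -TE.
have -> : v m - T (v m) - (v n - T (v n)) = v m - (T (v m) + (v n - T (v n))).
  by rewrite [in RHS]opprD addrA.
have [rm _ dm] := vP m; have [rn _ _] := vP n; apply: dm.
have sr := subspace_range_bop (T ^+ m.+1).
apply: subspace_setD => //; first exact: (shift m m).
apply: subspace_setB => //; last exact: (shift m n _ (ltnW mn)).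
exact: (range_expr_mono mn).
Qed.

Lemma index_expr (S : bop X) k n : has_index S k -> has_index (S ^+ n) (k *+ n).
Proof.
move=> Sk; elim: n => [|n IH].
  by rewrite expr0 mulr0n; exact: (@has_index_bij _ _ _ _ id).
rewrite exprS mulrSr (_ : (S * S ^+ n : bop X) = S \o (S ^+ n) :> (X -> X))//.
by apply: has_index_comp => //; exact: bop_linear.
Qed.

(** For large p, the space is the direct sum of the kernel and the range of T^p. Hence
T^p has index 0; but that index is also p times the index of T. *)
Lemma index_one_minus_compact : has_index T 0.
Proof.
have [p1 kP] := ker_chain_stable; have [p2 rP] := range_chain_stable.
pose p := (maxn p1 p2).+1.
have p1p : (p1 <= p)%N by rewrite leqW// leq_maxl.
have p2p : (p2 <= p)%N by rewrite leqW// leq_maxr.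
have ker_fin n : finite_quot_dim (ker_set (T ^+ n)) [set 0].
  by have [L cL ->] := one_minus_compact_expr n; exact: finite_dim_ker.
have [a ha] := ker_fin p.
(* A basis of the kernel of T^p is also one of a complement of its range. *)
have hb : has_quot_dim [set: X] (range (T ^+ p)) a.
  move: (ha) => [e [eV eI eS]]; exists e; split=> //.
    move=> c [y _ yE]; apply: eI; rewrite /= -yE.
    have : ker_set (T ^+ (p + p)) y.
      rewrite /ker_set /= exprD bopME yE.
      have [_ _ _ _ ->] := linear_props (bop_linear (T ^+ p)).
      by rewrite big1// => i _; rewrite (eV i : _ = 0) scaler0.
    by move=> /kP /(ker_expr_mono p1p).
  move=> x _.
  have [|y _ yE] := rP (p + p)%N ((T ^+ p) x).
    by apply: (range_expr_mono p2p); exists x.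
  have [|c cE] := eS (x - (T ^+ p) y).
    by rewrite /ker_set /= bopxB -yE exprD bopME subrr.
  exists c; exists y => //.
  by apply/eqP; rewrite eq_sym -subr_eq0 addrAC; exact/eqP.
have Tp0 : has_index (T ^+ p) 0 by exists a, a; rewrite subrr.
have [k hk] : exists k, has_index T k.
  apply: has_index_exists; first by have := ker_fin 1%N; rewrite expr1.
  apply: (@finite_quot_dim_super _ _ _ _ (range (T ^+ p))); last by exists a.
    exact: subspace_range_bop.
  by have := @range_expr_mono 1 p isT; rewrite expr1.
have := has_index_uniq (bop_linear _) Tp0 (index_expr p hk).
by move/esym/eqP; rewrite mulrn_eq0 /= => /eqP <-.
Qed.

End OneMinusCompact.

(** L has norm at most 1/2: the solution of x + L x = y is the alternating series
y - L y + L (L y) - ..., and the norm of x is at most twice that of x + L x, which makes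
the inverse bounded. *)
Lemma neumann (L : bop X) : (forall x, rnorm (L x) <= 2^-1 * rnorm x) ->
  exists H : bop X, (1 + L) * H = 1 /\ H * (1 + L) = 1.
Proof.
move=> Lh; pose G := 1 + L.
have Gb x : rnorm x <= 2 * rnorm (G x).
  have := Lh x; have := rnormB (G x) (L x).
  by rewrite {1}/G bopDE bop1E addrK; lra.
have Gi : injective G.
  move=> x y Gxy; apply/eqP; rewrite -subr_eq0; apply/eqP/rnorm_eq0.
  have := Gb (x - y); rewrite bopxB Gxy subrr rnorm0 mulr0 => h.
  by apply/eqP; rewrite eq_le h rnorm_ge0.
have Gs y : exists x, G x = y.
  pose r n := iter n (fun z => - L z) y.
  have rE n : r n.+1 = - L (r n) by [].
  have rn n : rnorm (r n) <= rnorm y * 2^-1 ^+ n.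
    elim: n => [|n IH]; first by rewrite mulr1.
    rewrite rE rnormN; have := Lh (r n); rewrite exprS; lra.
  pose S n := \sum_(i < n) r i.
  have [||s sP] := @rnorm_limit R X (rnorm y) S; first exact: rnorm_ge0.
    by move=> n; rewrite /S big_ord_recr /= addrAC subrr add0r.
  have GS n : G (S n) = y - r n.
    elim: n => [|n IH]; first by rewrite /S big_ord0 bopx0 subrr.
    have -> : S n.+1 = S n + r n by rewrite /S big_ord_recr.
    rewrite bopxD IH rE /G bopDE bop1E opprK.
    by rewrite addrA subrK.
  exists s; apply/eqP; rewrite -subr_eq0; apply/eqP; apply: rnorm_small_eq0 => e e0.
  have [M [M0 MG]] := bop_bound G.
  have y0 : 0 <= rnorm y := rnorm_ge0 y.
  have [|n nP] := @half_expr_smallM R (M * (2 * rnorm y) + rnorm y) e _ e0.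
    by rewrite addr_ge0// mulr_ge0 ?mulr_ge0// ltW.
  apply: le_lt_trans nP.
  have -> : G s - y = G (s - S n) - r n by rewrite bopxB GS opprB addrA addrAC addrK.
  apply: le_trans (rnormB _ _) _; rewrite mulrDl lerD//.
  by apply: le_trans (MG _) _; rewrite -mulrA ler_pM2l.
have /choice [H HP] := Gs.
have HG x : H (G x) = x by apply: Gi; rewrite HP.
have bH : bounded_op H.
  apply/bounded_opP; split; first by apply: (linear_inv (bop_linear G)).
  by exists 2; split=> // x; rewrite -{2}(HP x).
by exists (Bop bH); split; apply: bop_eq => x; [exact: HP|exact: HG].
Qed.

Lemma index_one_plus_compact (K : bop X) : cbop K -> has_index (1 + K) 0.
Proof.
move=> cK; have [_ _ cl _] := cbop_ideal X.
apply: (@index_one_minus_compact (- K)); last by rewrite opprK.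
by rewrite -mulN1r; exact: cl.
Qed.

(** An inverse modulo compact operators. *)
Definition parametrix (T Q : bop X) : Prop := cbop (T * Q - 1) /\ cbop (Q * T - 1).

Lemma parametrix_fredholm (T Q : bop X) : parametrix T Q ->
  finite_quot_dim (ker_set T) [set 0] /\ finite_quot_dim [set: X] (range T).
Proof.
move=> [cTQ cQT].
have [_ [b [_ hb _]]] := index_one_plus_compact cTQ.
have [a [_ [ha _ _]]] := index_one_plus_compact cQT.
rewrite addrC subrK in ha; rewrite addrC subrK in hb; split.
  apply: (@finite_quot_dim_sub _ _ (ker_set (Q * T))); last by exists a.
    exact: subspace_set0.
  by move=> x; rewrite /ker_set /= => ->; exact: bopx0.
apply: (@finite_quot_dim_super _ _ _ _ (range (T * Q))); last by exists b.
  exact: subspace_range_bop.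
by move=> _ [x _ <-]; exists (Q x).
Qed.

Lemma parametrix_index (T Q : bop X) : parametrix T Q -> exists k, has_index T k.
Proof. by move=> /parametrix_fredholm[]; exact: has_index_exists. Qed.

Lemma parametrix_sym (T Q : bop X) : parametrix T Q -> parametrix Q T.
Proof. by case. Qed.

Lemma index_mul (S T : bop X) k l : has_index S k -> has_index T l ->
  has_index (S * T) (k + l).
Proof.
move=> hS hT; rewrite addrC.
exact: has_index_comp (bop_linear T) (bop_linear S) hT hS.
Qed.

Lemma bop_index_uniq (T : bop X) k l : has_index T k -> has_index T l -> k = l.
Proof. exact: has_index_uniq (bop_linear T). Qed.

Lemma index_parametrix_opp (T Q : bop X) k : parametrix T Q ->
  has_index T k -> has_index Q (- k).
Proof.
move=> pTQ Tk; have [l Ql] := parametrix_index (parametrix_sym pTQ).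
have := index_one_plus_compact pTQ.1; rewrite addrC subrK => h.
have /eqP := bop_index_uniq (index_mul Tk Ql) h.
by rewrite addrC addr_eq0 => /eqP <-.
Qed.

(** The index is locally constant. With L = (S - T - K) Q of norm at most 1/2, the
product S Q is 1 + L modulo compact operators, hence of index 0, and so S has the
index opposite to that of Q, like T. Allowing a compact K makes invariance under
compact perturbations the special case L = 0. *)
Lemma index_perturb (T S Q : bop X) k : parametrix T Q ->
  has_index T k -> (exists l, has_index S l) ->
  (exists2 K, cbop K & forall x, rnorm (((S - T - K) * Q) x) <= 2^-1 * rnorm x) ->
  has_index S k.
Proof.
move=> pTQ Tk [l Sl] [K cK small].
have [_ cD cl cr] := cbop_ideal X.
have [H [GH HG]] := neumann small.
set L := (S - T - K) * Q in small GH HG.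
have Qk := index_parametrix_opp pTQ Tk.
have SQE : S * Q = (1 + L) * (1 + H * ((T * Q - 1) + K * Q)).
  rewrite [RHS]mulrDr mulr1 mulrA GH mul1r /L !mulrBl.
  move: (S * Q) (T * Q) (K * Q) => a b c.
  by rewrite (addrAC b) -(addrA a) -opprD -[RHS]addrA subrKA addrC subrK.
have h0 : has_index (S * Q) 0.
  rewrite SQE -[0]addr0; apply: index_mul.
    by apply: (@has_index_bij _ _ _ _ H (bop_linear _)) => x;
      rewrite -bopME ?GH ?HG.
  by apply: index_one_plus_compact; apply: cl; apply: cD; [exact: pTQ.1|exact: cr].
have /eqP := bop_index_uniq (index_mul Sl Qk) h0.
by rewrite subr_eq0 => /eqP <-.
Qed.

Lemma index_compact_perturb (T S Q : bop X) k : parametrix T Q ->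
  has_index T k -> cbop (S - T) -> has_index S k.
Proof.
move=> pTQ Tk cST; have [c0 cD cl cr] := cbop_ideal X.
have pSQ : parametrix S Q.
  split.
    have -> : S * Q - 1 = (S - T) * Q + (T * Q - 1) by rewrite mulrBl addrA subrK.
    by apply: cD; [exact: cr|exact: pTQ.1].
  have -> : Q * S - 1 = Q * (S - T) + (Q * T - 1) by rewrite mulrBr addrA subrK.
  by apply: cD; [exact: cl|exact: pTQ.2].
apply: (index_perturb pTQ Tk (parametrix_index pSQ)); exists (S - T) => //.
by move=> x; rewrite subrr mul0r rnorm0 mulr_ge0// rnorm_ge0.
Qed.

End RieszIndex.

(** * Toeplitz operators modulo an ideal *)

Section Ideal.
Variables (S : pzRingType) (I : S -> Prop).
Hypothesis idI : ideal_set I.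

Definition cong (a b : S) : Prop := I (a - b).

Let ID a b : I a -> I b -> I (a + b). Proof. by case: idI => _ h _ _; exact: h. Qed.
Let IMl a b : I b -> I (a * b). Proof. by case: idI => _ _ h _; exact: h. Qed.
Let IMr a b : I a -> I (a * b). Proof. by case: idI => _ _ _ h; exact: h. Qed.
Let IN a : I a -> I (- a). Proof. by rewrite -mulN1r; exact: IMl. Qed.

Lemma cong_refl a : cong a a. Proof. by rewrite /cong subrr; case: idI. Qed.
Lemma cong_sym a b : cong a b -> cong b a.
Proof. by rewrite /cong -[b - a]opprB; exact: IN. Qed.
Lemma cong_trans b a c : cong a b -> cong b c -> cong a c.
Proof. by rewrite /cong -[a - c](subrKA b); exact: ID. Qed.
Lemma congD a a' b b' : cong a a' -> cong b b' -> cong (a + b) (a' + b').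
Proof. by rewrite /cong opprD addrACA; exact: ID. Qed.
Lemma congN a a' : cong a a' -> cong (- a) (- a').
Proof. by rewrite /cong -opprD; exact: IN. Qed.
Lemma congB a a' b b' : cong a a' -> cong b b' -> cong (a - b) (a' - b').
Proof. by move=> aa bb; apply: congD => //; exact: congN. Qed.
Lemma congM a a' b b' : cong a a' -> cong b b' -> cong (a * b) (a' * b').
Proof.
move=> aa bb; apply: (@cong_trans (a * b')); rewrite /cong.
  by rewrite -mulrBr; exact: IMl.
by rewrite -mulrBl; exact: IMr.
Qed.
Lemma congMl c a a' : cong a a' -> cong (c * a) (c * a').
Proof. exact: congM (cong_refl c). Qed.
Lemma congMr c a a' : cong a a' -> cong (a * c) (a' * c).
Proof. by move=> aa; exact: congM aa (cong_refl c). Qed.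

Variable p : S.
Hypothesis pp : cong (p * p) p.

Definition toeplitz (u : S) : S := p * u * p - (1 - p).

(** For u commuting with p modulo the ideal this is congruent to [toeplitz u]; it is
preferred because it is affine in p and so in the operator F of a Fredholm module. *)
Definition half_toeplitz (u : S) : S := p * u - (1 - p).

Lemma toeplitz_cong u : cong (p * u) (u * p) -> cong (toeplitz u) (half_toeplitz u).
Proof.
move=> pu; apply: congB; last exact: cong_refl.
apply: (@cong_trans (u * (p * p))); first by rewrite mulrA; exact: congMr.
apply: (@cong_trans (u * p)); first exact: congMl.
exact: cong_sym.
Qed.

(** With q = 1 - p, modulo the ideal, p u q and q p v vanish, q q = q and
p u p v = p p u v = p u v. *)
Lemma half_toeplitzM u v : cong (p * u) (u * p) -> cong (p * v) (v * p) ->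
  cong (half_toeplitz u * half_toeplitz v) (p * (u * v) + (1 - p)).
Proof.
move=> pu pv; pose q := 1 - p.
have pq : cong (p * q) 0.
  by rewrite /q mulrBr mulr1 -(subrr p); apply: congB => //; exact: cong_refl.
have qp : cong (q * p) 0 by rewrite /q mulrBl mul1r -{1}(mulr1 p) -mulrBr.
have qq : cong (q * q) q.
  rewrite {1}/q mulrBl mul1r -[X in cong _ X]subr0.
  by apply: congB => //; exact: cong_refl.
have puq : cong (p * u * q) 0.
  apply: (@cong_trans (u * p * q)); first exact: congMr.
  by rewrite -(mulr0 u) -mulrA; exact: congMl.
have qpv : cong (q * (p * v)) 0.
  by rewrite -(mul0r v) mulrA; exact: congMr.
have pupv : cong (p * u * (p * v)) (p * (u * v)).
  rewrite [X in cong _ X]mulrA mulrA; apply: congMr.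
  apply: (@cong_trans (u * p * p)); first exact: congMr.
  apply: (@cong_trans (u * p)); first by rewrite -mulrA; exact: congMl.
  exact: cong_sym.
rewrite /half_toeplitz -/q; clearbody q; rewrite mulrBl !mulrBr.
have -> : p * (u * v) + q = p * (u * v) - 0 - (0 - q) by rewrite subr0 sub0r opprK.
by apply: congB; apply: congB.
Qed.

Lemma half_toeplitz_inv u v : cong (p * u) (u * p) -> cong (p * v) (v * p) ->
  u * v = 1 -> cong (half_toeplitz u * half_toeplitz v) 1.
Proof.
move=> pu pv uv; have := half_toeplitzM pu pv.
by rewrite uv mulr1 addrC subrK.
Qed.

End Ideal.

Section ToeplitzIndex.
Context {R : realType}.
Variable X : completeNormedModType R[i].
Local Notation cong := (cong (@cbop R X)).
Local Notation idc := (cbop_ideal X).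
Variable p : bop X.
Hypothesis pp : cong (p * p) p.

(** An almost commuting unit: commutation with p holds modulo compact operators only,
but invertibility is exact, which makes products of such units of the same kind. *)
Record acommuting_unit (u v : bop X) : Prop := {
  acu_l : u * v = 1;
  acu_r : v * u = 1;
  acu_comm : cong (p * u) (u * p);
  acu_comm_inv : cong (p * v) (v * p) }.

Lemma acommuting_unit1 : acommuting_unit 1 1.
Proof. by split; rewrite ?mulr1 ?mul1r//; exact: cong_refl idc _. Qed.

Lemma acommuting_unitM u u' v v' : acommuting_unit u u' -> acommuting_unit v v' ->
  acommuting_unit (u * v) (v' * u').
Proof.
have cM a b : cong (p * a) (a * p) -> cong (p * b) (b * p) ->
    cong (p * (a * b)) (a * b * p).
  move=> pa pb; apply: (@cong_trans _ _ idc (a * p * b)).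
    by rewrite mulrA; exact: (congMr idc).
  by rewrite -!mulrA; exact: (congMl idc).
case=> uu uu' pu pu' [vv vv' pv pv']; split; [| |exact: cM|exact: cM].
- by rewrite mulrA -(mulrA u) vv mulr1.
- by rewrite mulrA -(mulrA v') uu' mulr1.
Qed.

Lemma half_toeplitz_parametrix u v : acommuting_unit u v ->
  parametrix (half_toeplitz p u) (half_toeplitz p v).
Proof. by case=> uv vu pu pv; split; apply: (half_toeplitz_inv idc pp). Qed.

Lemma half_toeplitz_index u v : acommuting_unit u v ->
  exists k, has_index (half_toeplitz p u) k.
Proof. by move=> /half_toeplitz_parametrix; exact: parametrix_index. Qed.

(** The square of [half_toeplitz p 1] is 1 modulo compact operators, so twice its
index is 0. *)
Lemma half_toeplitz1_index : has_index (half_toeplitz p 1) 0.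
Proof.
have a1 := acommuting_unit1; have [k hk] := half_toeplitz_index a1.
have h0 := index_one_plus_compact (half_toeplitz_parametrix a1).1.
rewrite addrC subrK in h0.
have := bop_index_uniq (index_mul hk hk) h0.
by move=> /eqP; rewrite -mulr2n mulrn_eq0 /= => /eqP <-.
Qed.

(** Modulo compact operators, the product for u and v is [p * (u * v) + (1 - p)]; so
is the product for u v and 1, whose second factor has index 0. *)
Lemma half_toeplitz_indexM u u' v v' k l :
  acommuting_unit u u' -> acommuting_unit v v' ->
  has_index (half_toeplitz p u) k -> has_index (half_toeplitz p v) l ->
  has_index (half_toeplitz p (u * v)) (k + l).
Proof.
move=> au av hk hl; have auv := acommuting_unitM au av.
have [j hj] := half_toeplitz_index auv.
suff -> : k + l = j by [].
have hj1 := index_mul hj half_toeplitz1_index; rewrite addr0 in hj1.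
have hkl := index_mul hk hl.
have a1 := acommuting_unit1.
apply: (bop_index_uniq hkl).
have par : parametrix (half_toeplitz p (u * v) * half_toeplitz p 1)
    (half_toeplitz p 1 * half_toeplitz p (v' * u')).
  have [w1 w2] := half_toeplitz_parametrix auv.
  have [r1 _] := half_toeplitz_parametrix a1.
  split; rewrite -[cbop _]/(cong _ _).
    rewrite -mulrA (mulrA (half_toeplitz p 1)).
    apply: (cong_trans idc _ w1); apply: (congMl idc).
    by rewrite -[X in cong _ X]mul1r; exact: (congMr idc _ r1).
  rewrite -mulrA (mulrA _ _ (half_toeplitz p 1)).
  apply: (cong_trans idc _ r1); apply: (congMl idc).
  by rewrite -[X in cong _ X]mul1r; exact: (congMr idc _ w2).
apply: (index_compact_perturb par hj1).
rewrite -[cbop _]/(cong _ _).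
case: au => _ _ pu _; case: av => _ _ pv _; case: auv => _ _ puv _; case: a1 => _ _ p1 _.
apply: (cong_trans idc (half_toeplitzM idc pp pu pv)).
apply: (cong_sym idc); rewrite -[u * v]mulr1; exact: (half_toeplitzM idc pp).
Qed.

Lemma toeplitz_fredholm u v : acommuting_unit u v -> fredholm (toeplitz p u).
Proof.
move=> au; have par := half_toeplitz_parametrix au.
have [k hk] := half_toeplitz_index au.
have [_ _ pu _] := au.
have [a [b [ha hb _]]] := index_compact_perturb par hk (toeplitz_cong idc pp pu).
by split; [exact: bop_bounded|exists a|exists b].
Qed.

Lemma toeplitz_has_index u v k : acommuting_unit u v ->
  has_index (half_toeplitz p u) k -> has_index (toeplitz p u) k.
Proof.
move=> au hk; have [_ _ pu _] := au.
exact: index_compact_perturb (half_toeplitz_parametrix au) hk (toeplitz_cong idc pp pu).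
Qed.

End ToeplitzIndex.

(** * Matrices of operators and the index of a Fredholm module *)

Section Amplification.
Context {R : realType}.
Local Notation C := R[i].
Variables (n : nat) (X : completeNormedModType C).
Local Notation Y := (bsum n X).

Lemma rnorm_bsum (x : Y) : rnorm x = \sum_i rnorm (x i).
Proof. by rewrite /rnorm bsum_normE raddf_sum. Qed.

Lemma rnorm_coord (x : Y) i : rnorm (x i) <= rnorm x.
Proof.
by rewrite rnorm_bsum (bigD1 i)//= lerDl sumr_ge0// => j _; exact: rnorm_ge0.
Qed.

Fact amp_bounded (A : 'M[bop X]_n) :
  bounded_op (fun x : Y => [ffun i => \sum_j A i j (x j)] : Y).
Proof.
apply/bounded_opP; split.
  move=> c x y; apply/ffunP => i; rewrite !ffunE scaler_sumr -big_split /=.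
  by apply: eq_bigr => j _; rewrite !ffunE linearP.
have /choice [M MP] : forall ij : 'I_n * 'I_n, exists M : R,
    0 < M /\ forall x, rnorm (A ij.1 ij.2 x) <= M * rnorm x.
  by move=> ij; exact: bop_bound.
exists (\sum_i \sum_j M (i, j) + 1); split.
  rewrite ltr_wpDl// sumr_ge0// => i _; rewrite sumr_ge0// => j _.
  exact: ltW (MP (i, j)).1.
move=> x; rewrite mulrDl; apply: (@le_trans _ _ ((\sum_i \sum_j M (i, j)) * rnorm x)); last first.
  by rewrite lerDl mul1r rnorm_ge0.
rewrite rnorm_bsum mulr_suml; apply: ler_sum => i _; rewrite ffunE mulr_suml.
apply: le_trans (rnorm_sum _) _; apply: ler_sum => j _.
have [M0 h] := MP (i, j); apply: le_trans (h _) _.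
by rewrite ler_pM2l//; exact: rnorm_coord.
Qed.

(** As [amp] is a ring homomorphism from matrices of operators on X, identities and
compactness on the n-fold sum of X can be checked entry by entry. *)
Definition amp (A : 'M[bop X]_n) : bop Y := Bop (amp_bounded A).

Lemma ampE A x i : amp A x i = \sum_j A i j (x j).
Proof. by rewrite ffunE. Qed.

Lemma ampM A B : amp (A *m B) = amp A * amp B.
Proof.
apply: bop_eq => x; apply/ffunP => i; rewrite bopME !ampE.
under [RHS]eq_bigr do rewrite ampE linear_sum.
rewrite exchange_big /=; apply: eq_bigr => j _.
by rewrite mxE bop_sumE; apply: eq_bigr => k _.
Qed.

Lemma ampB A B : amp (A - B) = amp A - amp B.
Proof.
apply: bop_eq => x; apply/ffunP => i; rewrite bopBE !ffunE -sumrB.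
by apply: eq_bigr => j _; rewrite !mxE.
Qed.

Lemma amp_scalarE (a : bop X) x i : amp a%:M x i = a (x i).
Proof.
rewrite ampE (bigD1 i)//= mxE eqxx big1 ?addr0// => j ji.
by rewrite mxE eq_sym (negPf ji).
Qed.

Lemma amp1 : amp 1%:M = 1.
Proof. by apply: bop_eq => x; apply/ffunP => i; rewrite amp_scalarE. Qed.

(** The operator is the sum over i and j of its entries, each preceded by the j-th
projection and followed by the i-th injection. *)
Lemma amp_compact (A : 'M[bop X]_n) : (forall i j, cbop (A i j)) -> cbop (amp A).
Proof.
move=> cA.
pose pr j (x : Y) : X := x j.
have bpr j : bounded_op (pr j).
  apply/bounded_opP; split; first by move=> c x y; rewrite /pr !ffunE.
  by exists 1; split=> // x; rewrite mul1r; exact: rnorm_coord.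
pose inj i (x : X) : Y := [ffun k => if k == i then x else 0].
have binj i : bounded_op (inj i).
  apply/bounded_opP; split.
    move=> c x y; apply/ffunP => k; rewrite !ffunE; case: eqP => // _.
    by rewrite scaler0 addr0.
  exists 1; split=> // x; rewrite mul1r rnorm_bsum (bigD1 i)//= ffunE eqxx.
  rewrite big1 ?addr0// => k ki; rewrite ffunE (negPf ki); exact: rnorm0.
rewrite /cbop (_ : (amp A : Y -> Y) = fun x => \sum_i \sum_j (inj i \o (A i j \o pr j)) x).
  apply: compact_op_sum => i; apply: compact_op_sum => j.
  exact: (compact_op_post (compact_op_pre (bop_linear _) (cA i j) (bpr j)) (binj i)).
apply/funext => x; apply/ffunP => k; rewrite ampE sum_ffunE [RHS](bigD1 k)//=.
rewrite [X in _ = _ + X]big1 ?addr0 => [|i ik].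
  by rewrite sum_ffunE; apply: eq_bigr => j _; rewrite ffunE eqxx.
by rewrite sum_ffunE big1// => j _; rewrite ffunE eq_sym (negPf ik).
Qed.

Lemma amp_cong (A B : 'M[bop X]_n) : (forall i j, cong (@cbop R X) (A i j) (B i j)) ->
  cong (@cbop R Y) (amp A) (amp B).
Proof. by move=> h; rewrite /cong -ampB; apply: amp_compact => i j; rewrite !mxE; exact: h. Qed.

End Amplification.

Lemma mulmx_scalarE (S : pzRingType) n (A : 'M[S]_n) a i j :
  (A *m a%:M) i j = A i j * a.
Proof.
rewrite mxE (bigD1 j)//= mxE eqxx big1 ?addr0// => k kj.
by rewrite mxE (negPf kj) mulr0.
Qed.

Lemma scalar_mulmxE (S : pzRingType) n (A : 'M[S]_n) a i j :
  (a%:M *m A) i j = a * A i j.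
Proof. by rewrite mul_scalar_mx mxE. Qed.

Section Modules.
Context {R : realType}.
Local Notation C := R[i].
Context {A : algType C}.
Implicit Type M : fredholm_module A.

Lemma fm_rep_bounded M a : bounded_op (@fm_rep _ _ M a).
Proof. by case: (fm_odd_fredholm M) => -[]. Qed.
Lemma fm_op_bounded M : bounded_op (@fm_op _ _ M).
Proof. by case: (fm_odd_fredholm M). Qed.

Definition rho M a : bop M := Bop (fm_rep_bounded M a).
Definition phi M : bop M := Bop (fm_op_bounded M).
Definition halfop M : bop M := Bop (@bounded_opZ _ M 2^-1).

(** The operator (1 + F) / 2; [halfop M] is central in the ring of bounded operators. *)
Definition fm_proj M : bop M := halfop M * (1 + phi M).

Lemma rhoM M a b : rho M (a * b) = rho M a * rho M b.
Proof. by apply: bop_eq => x; case: (fm_odd_fredholm M) => -[_ _ h] _ _ _; exact: h. Qed.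

Lemma rhoD M a b : rho M (a + b) = rho M a + rho M b.
Proof.
apply: bop_eq => x; case: (fm_odd_fredholm M) => -[_ h _] _ _ _.
by have := h 1 a b x; rewrite !scale1r.
Qed.

Lemma rho0 M : rho M 0 = 0.
Proof. by apply: (addrI (rho M 0)); rewrite -rhoD !addr0. Qed.

Lemma rho_sum M (I : finType) (f : I -> A) : rho M (\sum_i f i) = \sum_i rho M (f i).
Proof. by elim/big_rec2 : _ => [|i y z _ <-]; [exact: rho0|exact: rhoD]. Qed.

Lemma phi_sqr M : cbop (phi M * phi M - 1).
Proof. by have [_ _ h _] := fm_odd_fredholm M; exact: h. Qed.

Lemma phi_comm M a : cbop (phi M * rho M a - rho M a * phi M).
Proof. by have [_ _ _ h] := fm_odd_fredholm M; exact: h. Qed.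

Lemma halfC M (S : bop M) : halfop M * S = S * halfop M.
Proof. by apply: bop_eq => x; rewrite !bopME /= linearZ. Qed.

Lemma half_double M : halfop M + halfop M = 1.
Proof.
apply: bop_eq => x; rewrite bopDE /= -scalerDl.
have -> : 2^-1 + 2^-1 = 1 :> C by field.
by rewrite scale1r.
Qed.

Lemma proj_sqr M :
  fm_proj M * fm_proj M - fm_proj M = halfop M * halfop M * (phi M * phi M - 1).
Proof.
rewrite /fm_proj; set h := halfop M; set f := phi M.
have -> : h * (1 + f) * (h * (1 + f)) = h * h * ((1 + f) * (1 + f)).
  by rewrite !mulrA -(mulrA h _ h) -halfC -/h mulrA.
have -> : h * (1 + f) = h * h * ((1 + f) + (1 + f)).
  by rewrite [RHS]mulrDr -[RHS]mulrDl -mulrDr half_double mulr1.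
rewrite -mulrBr; congr (_ * _).
rewrite mulrDl mul1r mulrDr mulr1; move: (f * f) => g.
by rewrite opprD addrACA subrr add0r (addrC 1 f) opprD addrACA subrr add0r.
Qed.

Lemma proj_comm M a : fm_proj M * rho M a - rho M a * fm_proj M
  = halfop M * (phi M * rho M a - rho M a * phi M).
Proof.
rewrite /fm_proj; move: (rho M a) (phi M) => r f.
rewrite [X in _ - X]mulrA -(halfC r) -!mulrA -mulrBr; congr (_ * _).
rewrite mulrDl mulrDr mul1r mulr1.
by rewrite opprD addrACA subrr add0r.
Qed.

(** The relations defining K^1 involve modules that are not unital. There pi(u) is only
invertible on the range of pi(1); adding the complementary idempotent makes it
invertible. For unital modules nothing is added. *)
Definition unitize M n (u : 'M[A]_n) : 'M[bop M]_n :=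
  map_mx (rho M) u + (1 - rho M 1)%:M.

Lemma unitize1 M n : unitize M (1%:M : 'M[A]_n) = 1%:M.
Proof.
apply/matrixP => i j; rewrite !mxE; case: eqP => _.
  by rewrite addrC subrK.
by rewrite rho0 addr0.
Qed.

Lemma unitizeM M n (u v : 'M[A]_n) : unitize M (u *m v) = unitize M u *m unitize M v.
Proof.
rewrite /unitize mulmxDl !mulmxDr.
have ee : (1 - rho M 1) * (1 - rho M 1) = 1 - rho M 1.
  by rewrite mulrBr mulr1 mulrBl mul1r -rhoM mulr1 subrr subr0.
have -> : map_mx (rho M) u *m (1 - rho M 1)%:M = 0.
  by apply/matrixP => i j; rewrite mulmx_scalarE !mxE mulrBr mulr1 -rhoM mulr1 subrr.
have -> : (1 - rho M 1)%:M *m map_mx (rho M) v = 0.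
  by apply/matrixP => i j; rewrite scalar_mulmxE !mxE mulrBl mul1r -rhoM mul1r subrr.
rewrite -scalar_mxM ee addr0 add0r; congr (_ + _).
apply/matrixP => i j; rewrite !mxE rho_sum; apply: eq_bigr => k _.
by rewrite !mxE rhoM.
Qed.

Lemma unitize_comm M n (u : 'M[A]_n) i j :
  cbop (fm_proj M * unitize M u i j - unitize M u i j * fm_proj M).
Proof.
have [c0 cD cl cr] := cbop_ideal M.
have cN (S : bop M) : cbop S -> cbop (- S) by move=> cS; rewrite -mulN1r; exact: cl.
have h a : cbop (fm_proj M * rho M a - rho M a * fm_proj M).
  by rewrite proj_comm; apply: cl; exact: phi_comm.
rewrite !mxE mulrDr mulrDl opprD addrACA; apply: cD; first exact: h.
case: eqP => _; last by rewrite mulr0n mulr0 mul0r subrr.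
rewrite mulr1n mulrBr mulrBl mulr1 mul1r.
by rewrite subrACA subrr sub0r; apply: cN; exact: h.
Qed.

Definition projn M n : bop (bsum n M) := amp (fm_proj M)%:M.
Definition unitn M n (u : 'M[A]_n) : bop (bsum n M) := amp (unitize M u).

Lemma projn_idem M n : cong (@cbop _ _) (projn M n * projn M n) (projn M n).
Proof.
rewrite /projn -ampM -scalar_mxM; apply: amp_cong => i j.
have [c0 _ cl _] := cbop_ideal M.
rewrite !mxE; case: eqP => _; last exact: (cong_refl (cbop_ideal M)).
by rewrite /cong !mulr1n proj_sqr; apply: cl; exact: phi_sqr.
Qed.

Lemma projn_comm M n (u : 'M[A]_n) :
  cong (@cbop _ _) (projn M n * unitn M u) (unitn M u * projn M n).
Proof.
rewrite /projn /unitn -!ampM; apply: amp_cong => i j.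
by rewrite scalar_mulmxE mulmx_scalarE; exact: unitize_comm.
Qed.

Lemma unitn1 M n : unitn M (1%:M : 'M[A]_n) = 1.
Proof. by rewrite /unitn unitize1 amp1. Qed.

Lemma unitnM M n (u v : 'M[A]_n) : unitn M (u *m v) = unitn M u * unitn M v.
Proof. by rewrite /unitn unitizeM ampM. Qed.

Lemma unitn_unit M n (u v : 'M[A]_n) : u *m v = 1%:M -> v *m u = 1%:M ->
  acommuting_unit (projn M n) (unitn M u) (unitn M v).
Proof.
by move=> uv vu; split; rewrite -?unitnM ?uv ?vu ?unitn1//; exact: projn_comm.
Qed.

Definition half_comp M n (u : 'M[A]_n) : bop (bsum n M) :=
  half_toeplitz (projn M n) (unitn M u).

Lemma compressionE M n (u : 'M[A]_n) : unital M ->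
  compression M u = toeplitz (projn M n) (unitn M u) :> (bsum n M -> bsum n M).
Proof.
move=> uM.
have PnE x : Pn x = projn M n x.
  by apply/ffunP => i; rewrite /projn amp_scalarE ffunE.
have unE x : un u x = unitn M u x.
  apply/ffunP => i; rewrite ampE ffunE; apply: eq_bigr => j _.
  rewrite !mxE (_ : rho M 1 = 1) ?subrr ?mul0rn ?addr0//.
  by apply: bop_eq => y; exact: uM.
by apply/funext => x; rewrite /compression !PnE unE.
Qed.

(** The index of the pairing, for modules that need not be unital. *)
Definition mod_index M n (u : 'M[A]_n) (k : int) : Prop := has_index (half_comp M u) k.

Lemma mod_index_exists M n (u : 'M[A]_n) : invertible_mx u -> exists k, mod_index M u k.
Proof.
by move=> [v [uv vu]]; exact (half_toeplitz_index (projn_idem M n) (unitn_unit M uv vu)).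
Qed.

Lemma mod_index_uniq M n (u : 'M[A]_n) k l : mod_index M u k -> mod_index M u l -> k = l.
Proof. exact: bop_index_uniq. Qed.

Lemma mod_index1 M n : mod_index M (1%:M : 'M[A]_n) 0.
Proof.
by rewrite /mod_index /half_comp unitn1; exact: half_toeplitz1_index (projn_idem M n).
Qed.

Lemma mod_indexM M n (u v : 'M[A]_n) k l : invertible_mx u -> invertible_mx v ->
  mod_index M u k -> mod_index M v l -> mod_index M (u *m v) (k + l).
Proof.
move=> [u' [uu u'u]] [v' [vv v'v]] hk hl; rewrite /mod_index /half_comp unitnM.
exact: (half_toeplitz_indexM (projn_idem M n) (unitn_unit M uu u'u) (unitn_unit M vv v'v)).
Qed.

Lemma compression_fredholm M n (u : 'M[A]_n) : invertible_mx u -> unital M ->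
  fredholm (compression M u).
Proof.
move=> [v [uv vu]] /compressionE ->.
exact (toeplitz_fredholm (projn_idem M n) (unitn_unit M uv vu)).
Qed.

Lemma compression_index M n (u : 'M[A]_n) k : invertible_mx u -> unital M ->
  mod_index M u k -> fredholm_index (compression M u) = k.
Proof.
move=> [v [uv vu]] /compressionE -> hk.
have [a [b [ha hb ->]]] := toeplitz_has_index (projn_idem M n) (unitn_unit M uv vu) hk.
rewrite /fredholm_index (quot_dimP (@subspace_set0 _ _) ha).
by rewrite (quot_dimP (subspace_range_bop _) hb).
Qed.

End Modules.

(** * Invariance of the index under the relations of K-homology *)

Section Connected.
Context {R : realType}.

(** Otherwise the indicator function of the points where g differs from g 0 would be
continuous on the unit interval and take the values 0 and 1 only, against the
intermediate value theorem. *)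
Lemma locally_constant_unit_interval (T : Type) (g : R -> T) :
  (forall t : R, t \in `[0, 1] -> \forall s \near within `[0, 1] (nbhs t), g s = g t) ->
  g 0 = g 1.
Proof.
move=> loc; apply: contrapT => g01.
pose f t : R := if `[< g t = g 0 >] then 0 else 1.
have cf : {within `[0, 1], continuous f}.
  apply/subspace_continuousP => t t01 A /nbhs_singleton At.
  rewrite nbhs_filterE /=; apply: filterS (loc t t01) => s /= gs.
  by move: At; rewrite /from_subspace /f gs.
have [|c _] := @IVT R f 0 1 (2^-1) ler01 cf.
  rewrite /f asboolT// asboolF => [|h]; last by apply: g01.
  rewrite minEle maxEle ler01; apply/andP; split; lra.
by rewrite /f; case: asbool => h; clear -h; lra.
Qed.

End Connected.

Section Invariance.
Context {R : realType}.
Local Notation C := R[i].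
Context {A : algType C}.
Implicit Types M N : fredholm_module A.

Lemma bsumBE (X : completeNormedModType C) n (x y : bsum n X) i : (x - y) i = x i - y i.
Proof. by rewrite !ffunE. Qed.

Lemma half_compE M n (u : 'M[A]_n) x i : half_comp M u x i =
  fm_proj M (\sum_j unitize M u i j (x j)) - (x i - fm_proj M (x i)).
Proof.
rewrite /half_comp /half_toeplitz 2!bopBE bopME bop1E 2!bsumBE.
by rewrite /projn 2!amp_scalarE /unitn ampE.
Qed.

Lemma unitizeE M n (u : 'M[A]_n) i j x :
  unitize M u i j x = fm_rep (u i j) x + (x - fm_rep 1 x) *+ (i == j).
Proof.
rewrite !mxE bopDE; congr (_ + _); case: eqP => _.
  by rewrite !mulr1n.
by rewrite !mulr0n.
Qed.

Lemma projE M x : fm_proj M x = 2^-1 *: (x + fm_op x).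
Proof. by []. Qed.

(** These maps give both the isomorphisms of modules and the two components of an
isomorphism onto a direct sum. *)
Definition intertwiner M N (f : M -> N) : Prop :=
  [/\ linear f, forall a x, f (fm_rep a x) = fm_rep a (f x)
    & forall x, f (fm_op x) = fm_op (f x)].

Lemma half_comp_intertwine M N (f : M -> N) n (u : 'M[A]_n) (x : bsum n M) i :
  intertwiner f ->
  f (half_comp M u x i) = half_comp N u ([ffun j => f (x j)] : bsum n N) i.
Proof.
move=> [lf fpi fF]; have [f0 fD fB fZ fS] := linear_props lf.
have fproj y : f (fm_proj M y) = fm_proj N (f y) by rewrite !projE fZ fD fF.
rewrite !half_compE !fB !fproj ffunE; congr (fm_proj N _ - _).
have -> : f (\sum_j unitize M u i j (x j)) = \sum_j f (unitize M u i j (x j)).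
  by elim/big_ind2 : _ => // y1 y2 z1 z2 <- <-; rewrite fD.
apply: eq_bigr => j _; rewrite !unitizeE ffunE fD fpi; congr (_ + _).
by case: eqP => _; rewrite ?mulr0n// !mulr1n fB fpi.
Qed.

Lemma mod_index_iso M N n (u : 'M[A]_n) k : fm_isomorphic M N ->
  mod_index M u k -> mod_index N u k.
Proof.
move=> [U [V [[[lU _] [lV _] UV VU] pE FE]]].
have iU : intertwiner U by split=> // [a x|x]; [rewrite pE VU|rewrite FE VU].
apply: (@has_index_conj _ _ _ (fun x : bsum n N => [ffun j => U (x j)] : bsum n M)
  (fun x : bsum n M => [ffun j => V (x j)] : bsum n N)).
- by move=> c x y; apply/ffunP => i; rewrite !ffunE lU.
- exact: bop_linear.
- exact: bop_linear.
- by move=> x; apply/ffunP => i; rewrite !ffunE UV.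
- by move=> x; apply/ffunP => i; rewrite !ffunE VU.
- by move=> x; apply/ffunP => i; rewrite ffunE half_comp_intertwine.
Qed.

Lemma mod_index_direct_sum M M0 M1 n (u : 'M[A]_n) k0 k1 : fm_direct_sum M M0 M1 ->
  mod_index M0 u k0 -> mod_index M1 u k1 -> mod_index M u (k0 + k1).
Proof.
move=> [U [V [[[lU _] [lV _] UV VU] pE FE]]] h0 h1.
have [_ VD _ _ _] := linear_props lV.
have i0 : intertwiner (fun x => (U x).1).
  by split=> [c x y|a x|x]; [rewrite lU|rewrite pE VU|rewrite FE VU].
have i1 : intertwiner (fun x => (U x).2).
  by split=> [c x y|a x|x]; [rewrite lU|rewrite pE VU|rewrite FE VU].
have := has_index_prod (bop_linear _) (bop_linear _) h0 h1.
apply: (@has_index_conj _ _ _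
  (fun x : bsum n M => (([ffun j => (U (x j)).1] : bsum n M0),
                          ([ffun j => (U (x j)).2] : bsum n M1)))
  (fun z : bsum n M0 * bsum n M1 => [ffun j => V (z.1 j, z.2 j)] : bsum n M)).
- move=> c x y; apply: injective_projections; apply/ffunP => i;
  by rewrite !ffunE lU.
- exact: bop_linear.
- by move=> c x y; apply: injective_projections; exact: bop_linear.
- by move=> x; apply/ffunP => i; rewrite !ffunE -surjective_pairing UV.
- by move=> [x y]; apply: injective_projections; apply/ffunP => i; rewrite !ffunE VU.
- move=> x; apply: injective_projections; apply/ffunP => i; rewrite ffunE.
    by rewrite (half_comp_intertwine _ _ _ i0).
  by rewrite (half_comp_intertwine _ _ _ i1).
Qed.

(** The computation that gives inverses modulo compact operators, made for the zero
ideal, gives honest inverses. *)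
Lemma mod_index_degenerate M n (u : 'M[A]_n) : invertible_mx u -> degenerate M ->
  mod_index M u 0.
Proof.
move=> [v [uv vu]] [FF Fpi].
pose I (S : bop (bsum n M)) := S = 0.
have idI : ideal_set I.
  split=> // [a b -> ->|a b ->|a b ->]; rewrite /I; [exact: addr0|exact: mulr0|exact: mul0r].
have FF0 : phi M * phi M = 1 by apply: bop_eq => x; exact: FF.
have pp : cong I (projn M n * projn M n) (projn M n).
  rewrite /cong /projn -ampM -scalar_mxM.
  have /eqP : fm_proj M * fm_proj M - fm_proj M = 0 by rewrite proj_sqr FF0 subrr mulr0.
  by rewrite subr_eq0 => /eqP ->; exact: subrr.
have cm (w : 'M[A]_n) : cong I (projn M n * unitn M w) (unitn M w * projn M n).
  rewrite /cong /projn /unitn -!ampM.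
  suff -> : (fm_proj M)%:M *m unitize M w = unitize M w *m (fm_proj M)%:M by exact: subrr.
  have h a : fm_proj M * rho M a = rho M a * fm_proj M.
    apply/eqP; rewrite -subr_eq0 proj_comm (_ : phi M * rho M a = rho M a * phi M).
      by rewrite subrr mulr0.
    by apply: bop_eq => x; exact: Fpi.
  apply/matrixP => i j; rewrite scalar_mulmxE mulmx_scalarE !mxE mulrDl mulrDr h.
  congr (_ + _); case: eqP => _; last by rewrite mulr0 mul0r.
  by rewrite mulr1n mulrBr mulrBl h mulr1 mul1r.
have inv (w w' : 'M[A]_n) : w *m w' = 1%:M -> half_comp M w * half_comp M w' = 1.
  move=> ww; apply/eqP; rewrite -subr_eq0; apply/eqP.
  by apply: (half_toeplitz_inv idI pp) => //; rewrite -unitnM ww unitn1.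
apply: (@has_index_bij _ _ _ _ (half_comp M v) (bop_linear _)) => x;
  by rewrite -bopME inv.
Qed.

Section Homotopy.
Variables (X : completeNormedModType C) (pi : A -> X -> X).

Lemma opnorm_bound (T : X -> X) x : bounded_op T -> rnorm (T x) <= opnorm T * rnorm x.
Proof.
move=> /bounded_opP[lT [M [M0 MT]]].
have [T0 _ _ TZ _] := linear_props lT.
have [->|x0] := eqVneq x 0; first by rewrite T0 !rnorm0 mulr0.
have rx0 : 0 < rnorm x.
  rewrite lt_neqAle rnorm_ge0 andbT eq_sym; apply: contra x0 => /eqP /rnorm_eq0 ->.
  by [].
rewrite -ler_pdivrMr//; apply: sup_upper_bound.
  split; first by exists (rnorm (T 0)), 0 => //=; rewrite normr0.
  exists M => _ [y /= y1 <-]; apply: le_trans (MT y) _.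
  rewrite ger_pMr//; move: y1; rewrite rnormE -(rmorph1 (real_complex R)) lecR.
  exact.
have E : rnorm ((rnorm x)^-1%:C)%C = (rnorm x)^-1 :> R.
  by rewrite rnorm_real gtr0_norm ?invr_gt0.
exists (((rnorm x)^-1%:C)%C *: x) => /=.
  by rewrite rnormE rnormZ E mulVf ?gt_eqF// rmorph1.
by rewrite -[LHS]/(rnorm _) TZ rnormZ E mulrC.
Qed.

(** At a vector z, the half-Toeplitz operators of F and G differ in each coordinate by
half of G - F applied to (u + 1) z; a small G - F therefore yields a perturbation
covered by [index_perturb]. *)
Lemma mod_index_near n (u : 'M[A]_n) (F : X -> X) (hF : odd_fredholm pi F) k :
  invertible_mx u -> mod_index (FredholmModule hF) u k ->
  exists2 d : R, 0 < d & forall (G : X -> X) (hG : odd_fredholm pi G),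
    (forall x, rnorm (G x - F x) <= d * rnorm x) ->
    mod_index (FredholmModule hG) u k.
Proof.
move=> iu hk; have [v [uv vu]] := iu.
pose M0 := FredholmModule hF.
have par := half_toeplitz_parametrix (projn_idem M0 n) (unitn_unit M0 uv vu).
pose Q : bop (bsum n X) := half_comp M0 v.
pose W : bop (bsum n X) := (unitn M0 u + 1) * Q.
have [c [c0 cW]] := bop_bound W.
exists c^-1; first by rewrite invr_gt0.
move=> G hG GF; pose M1 := FredholmModule hG.
have [l hl] := mod_index_exists M1 iu.
pose S : bop (bsum n X) := half_comp M1 u.
pose T : bop (bsum n X) := half_comp M0 u.
apply: (@index_perturb _ (bsum n X) T S Q k par hk); first by exists l.
exists 0; first by case: (cbop_ideal (bsum n X)).
move=> y; rewrite subr0; set z := Q y.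
have E i : ((S - T) z) i = 2^-1 *: (G ((W y) i) - F ((W y) i)).
  have GD (x1 x2 : X) : G (x1 + x2) = G x1 + G x2.
    by have [_ h _ _ _] := linear_props (fm_op_bounded M1).1; exact: h.
  have FD (x1 x2 : X) : F (x1 + x2) = F x1 + F x2.
    by have [_ h _ _ _] := linear_props (fm_op_bounded M0).1; exact: h.
  have -> : (W y) i = \sum_j unitize M0 u i j (z j) + z i.
    by rewrite /W bopME bopDE bop1E [LHS]ffunE ampE.
  pose w : X := \sum_j unitize M0 u i j (z j).
  have SE : S z i = 2^-1 *: (w + G w) - (z i - 2^-1 *: (z i + G (z i))).
    have -> : w = \sum_j unitize M1 u i j (z j).
      by apply: eq_bigr => j _; rewrite !unitizeE.
    exact (@half_compE M1 n u z i).
  have TE : T z i = 2^-1 *: (w + F w) - (z i - 2^-1 *: (z i + F (z i))).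
    exact (@half_compE M0 n u z i).
  rewrite bopBE bsumBE SE TE -/w; move: w (z i) {SE TE} => a b.
  rewrite GD FD.
  rewrite subrACA (subrACA b) subrr sub0r opprK -!scalerBr -scalerDr; congr (_ *: _).
  have h (x x1 x2 : X) : x + x1 - (x + x2) = x1 - x2.
    by rewrite opprD addrACA subrr add0r.
  by rewrite !h [in RHS]opprD addrACA.
rewrite bopME -/z rnorm_bsum.
apply: (@le_trans _ _ (\sum_i 2^-1 * (c^-1 * rnorm ((W y) i)))).
  apply: ler_sum => i _; rewrite E rnormZ rnorm_half ler_wpM2l ?invr_ge0//.
rewrite -mulr_sumr ler_wpM2l ?invr_ge0// -mulr_sumr -rnorm_bsum.
by rewrite mulrC ler_pdivrMr// mulrC.
Qed.

Lemma mod_index_homotopy n (u : 'M[A]_n) (F0 F1 : X -> X)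
    (h0 : odd_fredholm pi F0) (h1 : odd_fredholm pi F1) k :
  invertible_mx u -> operator_homotopic pi F0 F1 ->
  mod_index (FredholmModule h0) u k -> mod_index (FredholmModule h1) u k.
Proof.
move=> iu [F [F0E F1E oF cF]] hk.
have /choice [g gP] : forall t, exists k,
    forall h : odd_fredholm pi (F t), mod_index (FredholmModule h) u k.
  move=> t; have [h|nh] := pselect (odd_fredholm pi (F t)).
    have [l hl] := mod_index_exists (FredholmModule h) iu; exists l => h'.
    by rewrite (Prop_irrelevance h' h).
  by exists 0.
have g01 : g 0 = g 1.
  apply: locally_constant_unit_interval => t t01.
  have ht := oF t t01.
  have [d d0 dP] := mod_index_near iu (gP t ht).
  have /cvgrPdist_lt /(_ _ d0) := cF t t01.
  have win : \forall s \near within `[0, 1] (nbhs t), s \in `[0, 1].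
    by apply: withinT.
  apply: filterS2 win => s s01; rewrite sub0r normrN => sd.
  have hs := oF s s01.
  apply: (mod_index_uniq (gP s hs)); apply: dP => x.
  have bst : bounded_op (fun x => F s x - F t x).
    have [_ bs _ _] := hs; have [_ bt _ _] := ht.
    exact: (bop_bounded (Bop bs - Bop bt)).
  apply: le_trans (opnorm_bound x bst) _; rewrite ler_wpM2r ?rnorm_ge0//.
  by apply: ltW; apply: le_lt_trans sd; exact: ler_norm.
move: h0 h1 hk; rewrite -F0E -F1E => h0 h1 hk.
by rewrite (mod_index_uniq hk (gP 0 h0)) g01; exact: gP.
Qed.

End Homotopy.

Section Pairing.
Variable B : completeNormedModType C -> Prop.
Variables (n : nat) (u : 'M[A]_n).
Hypothesis iu : invertible_mx u.

(** The default value 0 is never returned: every generator has an index, by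
[mod_index_exists]. *)
Fixpoint word_index (w : khom_word B A) : int :=
  match w with
  | KhomGen M _ => xget 0 [set k | mod_index M u k]
  | KhomZero => 0
  | KhomOpp w => - word_index w
  | KhomAdd w w' => word_index w + word_index w'
  end.

Lemma word_index_gen M (hM : B M) : mod_index M u (word_index (KhomGen hM)).
Proof. by have [k hk] := mod_index_exists M iu; exact: (xgetPex 0 (ex_intro _ k hk)). Qed.

Lemma word_index_eq M (hM : B M) k : mod_index M u k -> word_index (KhomGen hM) = k.
Proof. by move=> hk; exact: mod_index_uniq (word_index_gen hM) hk. Qed.

Lemma khom_rel_index w w' : khom_rel w w' -> word_index w = word_index w'.
Proof.
elim=> {w w'} //.
- by move=> x y z _ -> _.
- by move=> x y _ /= ->.
- by move=> x x' y y' _ /= -> _ ->.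
- by move=> x y z /=; rewrite addrA.
- by move=> x y /=; rewrite addrC.
- by move=> x /=; rewrite add0r.
- by move=> x /=; rewrite addNr.
- move=> M N hM hN MN; apply/esym/word_index_eq.
  exact: mod_index_iso MN (word_index_gen hM).
- move=> X hX pi F0 F1 h0 h1 hom; apply/esym/word_index_eq.
  exact: (mod_index_homotopy h1 iu hom (@word_index_gen (FredholmModule h0) hX)).
- move=> M M0 M1 hM h0 h1 MM; apply: word_index_eq.
  exact: mod_index_direct_sum MM (word_index_gen h0) (word_index_gen h1).
- by move=> M hM dM; apply: word_index_eq; exact: mod_index_degenerate.
Qed.

Lemma khom_class_index M N (hM : B M) (hN : B N) k :
  khom_class hM = khom_class hN -> mod_index M u k -> mod_index N u k.
Proof.
move=> MN hk.
have : khom_class hM (KhomGen hN) by rewrite MN; exact: khom_refl.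
by move=> /khom_rel_index; rewrite (word_index_eq hM hk) => ->; exact: word_index_gen.
Qed.

End Pairing.

End Invariance.

(** * Invariance of the index under the relation of K-theory *)

Section Roots.
Context {R : realType}.
Local Notation C := R[i].
Variables (A : banach_algebra C) (n : nat).
Local Notation NA := (normed_space A).
Local Notation MA := 'M[A]_n.

(** Fixing this structure on the target of [mx_to_bsum] makes matrices over A a complete
space, the norm being the sum of the norms of the entries. *)
Definition mx_space : completeNormedModType C := bsum n (bsum n NA).

Definition mx_to_bsum (x : MA) : mx_space :=
  ([ffun i => [ffun j => x i j : NA]] : bsum n (bsum n NA)).
Definition mnorm (x : MA) : R := rnorm (mx_to_bsum x).

Lemma mx_to_bsumE x i j : (mx_to_bsum x : bsum n (bsum n NA)) i j = x i j.
Proof. by rewrite 2!ffunE. Qed.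

Lemma mx_to_bsumB x y : mx_to_bsum (x - y) = mx_to_bsum x - mx_to_bsum y.
Proof. by apply/ffunP => i; apply/ffunP => j; rewrite !ffunE !mxE. Qed.

Lemma mnormE x : mnorm x = \sum_i \sum_j rnorm (x i j : NA).
Proof.
rewrite /mnorm rnorm_bsum; apply: eq_bigr => i _.
by rewrite rnorm_bsum; apply: eq_bigr => j _; rewrite !ffunE.
Qed.

Lemma mnorm_ge0 x : 0 <= mnorm x. Proof. exact: rnorm_ge0. Qed.

Lemma mdistC x y : mnorm (x - y) = mnorm (y - x).
Proof. by rewrite /mnorm !mx_to_bsumB rdistC. Qed.

Lemma mdist_triangle y x z : mnorm (x - z) <= mnorm (x - y) + mnorm (y - z).
Proof. by rewrite /mnorm !mx_to_bsumB; exact: rdist_triangle. Qed.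

Lemma mnorm0 : mnorm 0 = 0.
Proof. by rewrite -(subrr 0) /mnorm mx_to_bsumB subrr rnorm0. Qed.

Lemma mnormN x : mnorm (- x) = mnorm x.
Proof. by rewrite -sub0r mdistC subr0. Qed.

Lemma mnormD x y : mnorm (x + y) <= mnorm x + mnorm y.
Proof.
have := mdist_triangle 0 x (- y); by rewrite !opprK subr0 add0r.
Qed.

Lemma mdist_eq0 x y : mnorm (x - y) = 0 -> x = y.
Proof.
rewrite /mnorm mx_to_bsumB => /rnorm_eq0 /eqP; rewrite subr_eq0 => /eqP xy.
apply/matrixP => i j; have := congr1 (fun z : bsum n (bsum n NA) => z i j) xy.
by rewrite !ffunE.
Qed.

Lemma rnorm_mul (a b : A) : rnorm (a * b : NA) <= rnorm (a : NA) * rnorm (b : NA).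
Proof. by rewrite -lecR rmorphM /= -!rnormE; exact: na_normM. Qed.

Lemma mnormM x y : mnorm (x *m y) <= mnorm x * mnorm y.
Proof.
rewrite !mnormE mulr_suml; apply: ler_sum => i _.
rewrite mulr_suml.
apply: (@le_trans _ _ (\sum_j \sum_k rnorm (x i k : NA) * rnorm (y k j : NA))).
  apply: ler_sum => j _; rewrite mxE.
  apply: le_trans (rnorm_sum (fun k => x i k * y k j : NA)) _.
  by apply: ler_sum => k _; exact: rnorm_mul.
rewrite exchange_big /=; apply: ler_sum => k _; rewrite -mulr_sumr.
rewrite ler_wpM2l ?rnorm_ge0// [leRHS](bigD1 k)//= lerDl.
by apply: sumr_ge0 => l _; apply: sumr_ge0 => j _; exact: rnorm_ge0.
Qed.

Lemma mnorm_limit (c : R) (x : nat -> MA) : 0 <= c ->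
  (forall k, mnorm (x k.+1 - x k) <= c * 2^-1 ^+ k) ->
  exists s, forall k, mnorm (s - x k) <= 2 * c * 2^-1 ^+ k.
Proof.
move=> c0 xc.
have xc' k : rnorm (mx_to_bsum (x k.+1) - mx_to_bsum (x k)) <= c * 2^-1 ^+ k.
  by rewrite -mx_to_bsumB; exact: xc.
have [s sP] := rnorm_limit c0 xc'.
exists (\matrix_(i, j) (s : bsum n (bsum n NA)) i j) => k; rewrite /mnorm mx_to_bsumB.
have -> : mx_to_bsum (\matrix_(i, j) (s : bsum n (bsum n NA)) i j) = s.
  apply/ffunP => i.
  apply/ffunP => j.
  rewrite mx_to_bsumE.
  rewrite mxE.
  by [].
exact: sP.
Qed.

Definition mhalf (x : MA) : MA := map_mx (fun a : A => 2^-1 *: a) x.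

Lemma mhalfB x y : mhalf (x - y) = mhalf x - mhalf y.
Proof. by apply/matrixP => i j; rewrite !mxE scalerBr. Qed.

Lemma mhalf_double x : mhalf x + mhalf x = x.
Proof.
apply/matrixP => i j; rewrite !mxE -scalerDl.
have -> : 2^-1 + 2^-1 = 1 :> C by field.
by rewrite scale1r.
Qed.

Lemma mnorm_half x : mnorm (mhalf x) = 2^-1 * mnorm x.
Proof.
rewrite /mnorm (_ : mx_to_bsum _ = 2^-1 *: mx_to_bsum x) ?rnormZ ?rnorm_half//.
by apply/ffunP => i; apply/ffunP => j; rewrite 2![in RHS]ffunE !mx_to_bsumE mxE.
Qed.

(** The equation (1 + y)^2 = 1 + x reads y = (x - y^2) / 2, and the right-hand side is a
contraction of the ball of radius 1/2 into itself. The root 1 + y is as close to 1 as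
was asked of 1 + x, so that the construction can be iterated. *)
Lemma mx_sqrt_near1 x : mnorm x <= 2^-1 ->
  exists y, mnorm y <= 2^-1 /\ (1%:M + y) *m (1%:M + y) = 1%:M + x.
Proof.
move=> x2; pose f y := mhalf (x - y *m y).
have f2 y : mnorm y <= 2^-1 -> mnorm (f y) <= 2^-1.
  move=> y2; rewrite /f mnorm_half.
  have := mnormD x (- (y *m y)); have := mnormM y y; rewrite mnormN.
  have := ler_pM (mnorm_ge0 y) (mnorm_ge0 y) y2 y2.
  move: (mnorm (x - _)) (mnorm (y *m y)) (mnorm x) (mnorm y) x2 y2 => a b d e; lra.
have fc a b : mnorm a <= 2^-1 -> mnorm b <= 2^-1 ->
    mnorm (f a - f b) <= 2^-1 * mnorm (a - b).
  move=> a2 b2; rewrite /f -mhalfB mnorm_half ler_wpM2l ?invr_ge0//.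
  have -> : x - a *m a - (x - b *m b) = b *m (b - a) + (b - a) *m a.
    by rewrite subrACA subrr sub0r opprB mulmxBr mulmxBl addrA subrK.
  apply: le_trans (mnormD _ _) _; rewrite (mdistC a).
  have h1 : mnorm (b *m (b - a)) <= 2^-1 * mnorm (b - a).
    by apply: le_trans (mnormM _ _) _; rewrite ler_wpM2r ?mnorm_ge0.
  have h2 : mnorm ((b - a) *m a) <= 2^-1 * mnorm (b - a).
    apply: le_trans (mnormM _ _) _.
    by rewrite [leRHS]mulrC; exact: ler_wpM2l (mnorm_ge0 _) _ _ a2.
  apply: le_trans (lerD h1 h2) _; move: (mnorm (b - a)) => d; clear -R A n d; lra.
have [y [y0 yS]] : exists y : nat -> MA, y 0%N = 0 /\ forall k, y k.+1 = f (y k).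
  by exists (fun k => iter k f 0).
have y2 k : mnorm (y k) <= 2^-1.
  elim: k => [|k IH]; first by rewrite y0 mnorm0 invr_ge0.
  by rewrite yS; exact: f2.
have h0 : 0 <= 2^-1 :> R by rewrite invr_ge0.
have h1 : 2^-1 <= 1 :> R by clear -R A n; lra.
have yc k : mnorm (y k.+1 - y k) <= 2^-1 ^+ k.
  elim: k => [|k IH]; first by rewrite expr0 y0 subr0; exact: le_trans (y2 _) h1.
  rewrite exprS (yS k.+1) {2}(yS k).
  apply: (le_trans (fc _ _ (y2 _) (y2 _))); exact: ler_wpM2l h0 _ _ IH.
have yc1 k : mnorm (y k.+1 - y k) <= 1 * 2^-1 ^+ k by rewrite mul1r; exact: yc.
have [s sP] := mnorm_limit ler01 yc1.
have s2 : mnorm s <= 2^-1.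
  rewrite leNgt; apply/negP => h.
  have [||k kP] := @half_expr_smallM R (2 * 1) (mnorm s - 2^-1); [by []|by rewrite subr_gt0|].
  have := mnormD (s - y k) (y k); rewrite subrK; move: (sP k) (y2 k) kP h.
  move: (mnorm s) (mnorm (s - _)) (mnorm (y k)) => a b d; clear -R A n a b d; lra.
have fs : f s = s.
  apply: mdist_eq0; apply/eqP; rewrite eq_le mnorm_ge0 andbT leNgt; apply/negP => h.
  have [||k kP] := @half_expr_smallM R (2 * 2) (mnorm (f s - s)); [by []|by []|].
  have := mdist_triangle (y k.+1) (f s) s; have := fc _ _ s2 (y2 k).
  rewrite (mdistC (y k.+1)) -(yS k).
  move: kP (sP k) (sP k.+1) (exprn_ge0 k h0); rewrite exprS.
  move: (mnorm (s - y k)) (mnorm (s - y k.+1)) (mnorm (f s - s)) (mnorm (f s - _)).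
  by move=> a b d e; clear -R A n a b d e; lra.
exists s; split=> //.
rewrite mulmxDl !mulmxDr !mul1mx mulmx1 -addrA; congr (_ + _).
have := mhalf_double (x - s *m s); rewrite -/(f s) fs => h.
by rewrite addrA h subrK.
Qed.

End Roots.

Section K1.
Context {R : realType}.
Local Notation C := R[i].
Variable A : banach_algebra C.
Variable M : fredholm_module A.

Lemma invertible_mx_sqrt (S : pzRingType) n (u v : 'M[S]_n) :
  invertible_mx u -> v *m v = u -> invertible_mx v.
Proof.
move=> [w [uw wu]] vv; exists (v *m w).
have vw : v *m (v *m w) = 1%:M by rewrite mulmxA vv.
have wv : (w *m v) *m v = 1%:M by rewrite -mulmxA vv.
have vwE : v *m w = w *m v by rewrite -[LHS]mul1mx -wv -(mulmxA (w *m v)) vw mulmx1.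
by split=> //; rewrite vwE.
Qed.

Lemma invertible_mxM (S : pzRingType) n (u v : 'M[S]_n) :
  invertible_mx u -> invertible_mx v -> invertible_mx (u *m v).
Proof.
move=> [u' [uu u'u]] [v' [vv v'v]]; exists (v' *m u'); split.
  by rewrite mulmxA -(mulmxA u) vv mulmx1.
by rewrite mulmxA -(mulmxA v') u'u mulmx1.
Qed.

(** Take square roots k times; each one halves the index. *)
Lemma index_near1_divisible n (u : 'M[A]_n) k z : invertible_mx u ->
  mnorm (u - 1%:M) <= 2^-1 -> mod_index M u z -> exists z', z = z' *+ (2 ^ k).
Proof.
elim: k u z => [|k IH] u z iu u1 uz; first by exists z.
have [y [y2 yu]] := mx_sqrt_near1 u1.
rewrite [RHS]addrC subrK in yu.
have iv := invertible_mx_sqrt iu yu.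
have [l hl] := mod_index_exists M iv.
have -> : z = l + l.
  by apply: (mod_index_uniq uz); rewrite -yu; exact: mod_indexM.
have [|z' ->] := IH _ _ iv _ hl; first by rewrite addrC addKr.
by exists z'; rewrite -mulrnDr addnn -mul2n expnS.
Qed.

Lemma index_near1 n (u : 'M[A]_n) : invertible_mx u ->
  mnorm (u - 1%:M) <= 2^-1 -> mod_index M u 0.
Proof.
move=> iu u1; have [z uz] := mod_index_exists M iu.
suff z0 : z = 0 by rewrite -{1}z0.
(* A nonzero multiple of 2 ^ |z| would be larger than |z| in absolute value. *)
have [z' zE] := index_near1_divisible `|z|%N iu u1 uz.
have [z'0|z'0] := eqVneq z' 0; first by rewrite zE z'0 mul0rn.
have := ltn_expl `|z|%N (ltnSn 1).
have : (`|z|%N = `|z'|%N * 2 ^ `|z|%N)%N by rewrite {1}zE -mulr_natr abszM natz.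
have : (0 < `|z'|)%N by rewrite absz_gt0.
move: (2 ^ `|z|)%N => N; nia.
Qed.

(** The matrix w u^-1 is close to 1, so its index is 0. *)
Lemma index_near n (u w u' : 'M[A]_n) k : invertible_mx w ->
  u *m u' = 1%:M -> u' *m u = 1%:M -> mnorm (w - u) * mnorm u' <= 2^-1 ->
  mod_index M u k -> mod_index M w k.
Proof.
move=> iw uu u'u small uk.
have iu : invertible_mx u by exists u'.
have iu' : invertible_mx u' by exists u.
have iwu := invertible_mxM iw iu'.
have -> : w = (w *m u') *m u by rewrite -mulmxA u'u mulmx1.
rewrite -[k]add0r; apply: mod_indexM => //; apply: index_near1 => //.
by rewrite -uu -mulmxBl; apply: le_trans (mnormM _ _) _.
Qed.

(** The operator of diag(u, 1) is the direct sum of those of u and of an identity matrix,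
and the latter has index 0. *)
Lemma mod_index_stabilize_le n m (u : 'M[A]_n) (v : 'M[A]_m) k : (n <= m)%N ->
  invertible_mx u -> stabilize u = stabilize v -> mod_index M u k -> mod_index M v k.
Proof.
move=> nm; have [l ml] : exists l, m = (n + l)%N by exists (m - n)%N; rewrite subnKC.
subst m => iu uv uk.
have E (i j : 'I_(n + l)) : v i j = stabilize u i j.
  by rewrite uv /stabilize !valK.
have Ell (i j : 'I_n) : v (lshift l i) (lshift l j) = u i j.
  by rewrite E /stabilize !valK.
have nI (i : 'I_l) : insub (n + i)%N = None :> option 'I_n.
  by apply: insubF; rewrite ltnNge leq_addr.
have Elr (i : 'I_n) (j : 'I_l) : v (lshift l i) (rshift n j) = 0.
  rewrite E /stabilize valK /= nI; case: eqP => // ij.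
  by have := ltn_ord i; rewrite ij ltnNge leq_addr.
have Erl (i : 'I_l) (j : 'I_n) : v (rshift n i) (lshift l j) = 0.
  rewrite E /stabilize /= nI; case: eqP => // ij.
  by have := ltn_ord j; rewrite -ij ltnNge leq_addr.
have Err (i j : 'I_l) : v (rshift n i) (rshift n j) = (1%:M : 'M[A]_l) i j.
  by rewrite E /stabilize /= nI eqn_add2l mxE.
pose L (x : bsum (n + l) M) : bsum n M := [ffun i => x (lshift l i)].
pose Rr (x : bsum (n + l) M) : bsum l M := [ffun i => x (rshift n i)].
pose J (z : bsum n M * bsum l M) : bsum (n + l) M :=
  [ffun i => match fintype.split i with inl a => z.1 a | inr b => z.2 b end].
have unitizeE' r (w : 'M[A]_r) i j x :
   unitize M w i j x = fm_rep (w i j) x + (x - fm_rep 1 x) *+ (i == j) := unitizeE w i j x.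
rewrite -[k]addr0.
have := has_index_prod (bop_linear _) (bop_linear _) uk (mod_index1 M l).
apply: (@has_index_conj _ _ _ (fun x => (L x, Rr x)) J).
- move=> c x y; apply: injective_projections; apply/ffunP => i; by rewrite !ffunE.
- exact: bop_linear.
- by move=> c x y; apply: injective_projections; exact: bop_linear.
- move=> x; apply/ffunP => i; rewrite ffunE -{2}(splitK i).
  by case: (fintype.split i) => j /=; rewrite ffunE.
- move=> [x y]; apply: injective_projections; apply/ffunP => i; rewrite !ffunE.
    by rewrite (unsplitK (inl _)).
  by rewrite (unsplitK (inr _)).
have rep0 x : fm_rep (0 : A) x = 0 :> M.
  exact: (congr1 (fun T : bop M => T x) (rho0 M)).
move=> x; apply: injective_projections; apply/ffunP => i; rewrite ffunE !half_compE /= ffunE.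
  congr (fm_proj M _ - _); rewrite big_split_ord /= [X in _ + X]big1 ?addr0.
    by apply: eq_bigr => j _; rewrite !unitizeE ffunE Ell (inj_eq (@lshift_inj _ _)).
  by move=> j _; rewrite unitizeE Elr eq_lrshift mulr0n addr0 rep0.
congr (fm_proj M _ - _); rewrite big_split_ord /= [X in X + _]big1 ?add0r.
  by apply: eq_bigr => j _; rewrite !unitizeE ffunE Err (inj_eq (@rshift_inj _ _)).
by move=> j _; rewrite unitizeE Erl eq_rlshift mulr0n addr0 rep0.
Qed.

Lemma mod_index_stabilize n m (u : 'M[A]_n) (v : 'M[A]_m) k :
  invertible_mx u -> invertible_mx v ->
  stabilize u = stabilize v -> mod_index M u k -> mod_index M v k.
Proof.
move=> iu iv uv uk; have [nm|/ltnW mn] := leqP n m.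
  exact: mod_index_stabilize_le uv uk.
have [l vl] := mod_index_exists M iv.
by rewrite (mod_index_uniq uk (mod_index_stabilize_le mn iv (esym uv) vl)).
Qed.

Definition GLoo_index (g : GLoo A) (k : int) : Prop :=
  exists n (u : 'M[A]_n), [/\ invertible_mx u, GLoo_val g = stabilize u & mod_index M u k].

Lemma GLoo_index_exists g : exists k, GLoo_index g k.
Proof.
have [n [u [iu gu]]] := GLoo_prop g; have [k uk] := mod_index_exists M iu.
by exists k, n, u.
Qed.

Lemma GLoo_index_uniq g k n (u : 'M[A]_n) : GLoo_index g k ->
  invertible_mx u -> GLoo_val g = stabilize u -> mod_index M u k.
Proof.
move=> [m [v [iv gv vk]]] iu gu.
by apply: mod_index_stabilize vk => //; rewrite -gv.
Qed.

Lemma mx_nbhs_mnorm n (u : 'M[A]_n) (c : R) : 0 <= c ->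
  nbhs (u : 'M[normed_space A]_n)
    [set w : 'M[normed_space A]_n | mnorm ((w : 'M[A]_n) - u) * c <= 2^-1].
Proof.
move=> c0; pose D := (n * n)%:R * c.
have D0 : 0 <= D by rewrite mulr_ge0.
pose e := 2^-1 / (D + 1).
have e0 : 0 < e by rewrite divr_gt0// ltr_wpDl.
exists (fun i j => [set a : normed_space A | rnorm ((u i j : normed_space A) - a) < e]).
  by move=> i j; apply/rnorm_lt_nbhs; exists e.
move=> w wP /=.
have we : mnorm ((w : 'M[A]_n) - u) <= (n * n)%:R * e.
  rewrite mnormE; apply: (@le_trans _ _ (\sum_(i < n) \sum_(j < n) e)).
    apply: ler_sum => i _; apply: ler_sum => j _.
    by rewrite !mxE rdistC; apply: ltW; exact: wP.
  by rewrite !sumr_const !card_ord -mulrnA mulr_natl.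
apply: (@le_trans _ _ (D * e)).
  by rewrite /D mulrAC; exact: ler_wpM2r c0 _ _ we.
rewrite /e mulrA ler_pdivrMr ?ltr_wpDl//.
by move: D D0 {e e0 w wP we} => D D0; clear -R A D D0; lra.
Qed.

(** In the inductive limit topology it suffices to look at each GL_n, where the index is
locally constant by [index_near]. *)
Lemma GLoo_index_open k : open [set g : GLoo A | GLoo_index g k].
Proof.
move=> n.
pose S : set 'M[normed_space A]_n :=
  [set w | invertible_mx (w : 'M[A]_n) -> mod_index M (w : 'M[A]_n) k].
exists (interior S); first exact: open_interior.
apply/seteqP; split => u /=.
  move=> /interior_subset Su; have iu : invertible_mx (set_val u : 'M[A]_n) := set_valP u.
  by exists n, (set_val u : 'M[A]_n); split=> //; exact: Su.
move=> uk; have iu : invertible_mx (set_val u : 'M[A]_n) := set_valP u.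
have muk : mod_index M (set_val u : 'M[A]_n) k by apply: GLoo_index_uniq uk _ _.
have [u' [uu u'u]] := iu.
apply: filterS (mx_nbhs_mnorm (set_val u) (mnorm_ge0 u')) => w Bw iw.
exact: (index_near iw uu u'u Bw muk).
Qed.

Lemma K1_class_index n m (u : 'M[A]_n) (v : 'M[A]_m) (hu : invertible_mx u)
    (hv : invertible_mx v) k : K1_class hu = K1_class hv ->
  mod_index M u k -> mod_index M v k.
Proof.
move=> uv uk.
have : K1_class hu (GLoo_of hv).
  rewrite uv; exists (fun=> GLoo_of hv); split=> //.
  by apply: continuous_subspaceT => x; exact: cst_continuous.
move=> [g [cg g0 g1]].
have /choice [f fP] : forall t, exists k, GLoo_index (g t) k by move=> t; exact: GLoo_index_exists.
have f01 : f 0 = f 1.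
  apply: locally_constant_unit_interval => t t01.
  have /subspace_continuousP /(_ t t01) := cg.
  move=> /(_ [set h | GLoo_index h (f t)]) => h.
  have : nbhs (g t) [set h | GLoo_index h (f t)].
    by apply: open_nbhs_nbhs; split; [exact: GLoo_index_open|exact: fP].
  move=> /h gV.
  have : within `[0, 1] (nbhs t) [set s | GLoo_index (g s) (f t)] by exact: gV.
  apply: filterS => s gs.
  have [r [w [iw gw wf]]] := fP s.
  by apply: (mod_index_uniq wf); exact: GLoo_index_uniq gs iw gw.
have u0 : mod_index M u (f 0) by apply: (GLoo_index_uniq (fP 0)) => //; rewrite g0.
rewrite (mod_index_uniq uk u0) f01.
by apply: (GLoo_index_uniq (fP 1)) => //; rewrite g1.
Qed.

End K1.

Theorem theorem4p1 (R : realType) (B : completeNormedModType R[i] -> Prop)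
    (B_sum : stable_under_sums B) (B_zero : contains_zero_space B) :
  (forall (A : algType R[i]) (n : nat) (u : 'M[A]_n) (M : fredholm_module A),
     invertible_mx u -> unital M -> fredholm (compression M u))
  /\
  (forall (A : banach_algebra R[i]) (n m : nat) (u : 'M[A]_n) (v : 'M[A]_m)
     (hu : invertible_mx u) (hv : invertible_mx v)
     (M N : fredholm_module A) (hM : B M) (hN : B N),
     unital M -> unital N ->
     K1_class hu = K1_class hv -> khom_class hM = khom_class hN ->
     fredholm_index (compression M u)
     = fredholm_index (compression N v)).
Proof.
split=> [A n u M|A n m u v hu hv M N hM hN uM uN uv MN].
  exact: compression_fredholm.
have [k uk] := mod_index_exists M hu.
rewrite (compression_index hu uM uk); apply/esym.
apply: (compression_index hv uN); apply: (K1_class_index uv).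
exact: (khom_class_index hu MN uk).
Qed.
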